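(* Let $g \in F$ be an irreducible element, i.e. $g$, as a homeomorphism of $[0,1]$, fixes only $0$ and $1$. Then the translation length of $g$ acting on the $CAT(0)$ cubical complex $X$ equals $$\sqrt{(\log_2 g'(0))^2+(\log_2 g'(1))^2},$$ and if $g'(0)g'(1)\neq 1$ then $g$ is a parabolic isometry of $X$.
   Context: Thompson-like functions. For an integer $n\ge 1$ let $F_n$ be the set of piecewise linear homeomorphisms $g:[0,1]\to[0,n]$ with finitely many breaking points, all at dyadic rationals, and all slopes (integer) powers of $2$ (so $g$ is increasing). $F=F_1$ is Thompson's group and $F_\infty=\bigcup_{n\ge1}F_n$. Put $[n]=\{1,\dots,n\}$. For $J\subseteq[n]$ let $s_{n,J}:[0,n]\to[0,n+|J|]$ be the increasing piecewise linear bijection with slope $2$ on $[j-1,j]$ for $j\in J$ and slope $1$ on the other intervals $[j-1,j]$. For $g\in F_n$ put $g[J]=s_{n,J}\circ g\in F_{n+|J|}$. The complex $X$. For $g\in F_n$ let $C(g)$ be an $n$-dimensional unit cube $[0,1]^n$ whose vertex $\chi_J$ (the characteristic vector of $J\subseteq[n]$) is labeled by $g[J]$. $X$ is the cubical complex obtained by gluing the cubes $C(g)$, $g\in F_\infty$, along faces with the same labels; its vertex set is $F_\infty$. It carries the length metric $d$ for which every cube is a Euclidean unit cube; with it $X$ is a $CAT(0)$ space. The action. The group law of $F$ is taken in the order $gh:=h\circ g$, and $F$ acts on $X$ from the left by cubical isometries, given on vertices by $g\cdot x=x\circ g$. The translation length of an isometry $g$ is $|g|=\inf_{x\in X}d(gx,x)$;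 $g$ is parabolic if this infimum is not attained. $g'(0)$ and $g'(1)$ are one-sided derivatives. *)

(* Defs.v *)
From HB Require Import structures.
From Stdlib Require Import Relation_Operators.
From mathcomp Require Import all_boot all_order all_algebra generic_quotient.
From mathcomp Require Import all_classical all_reals all_analysis.
From mathcomp Require Import zify ring lra.
Import Order.TTheory GRing.Theory Num.Theory.
Import numFieldNormedType.Exports.

Set Implicit Arguments.
Unset Strict Implicit.
Unset Printing Implicit Defensive.

Local Open Scope classical_set_scope.
Local Open Scope ring_scope.
Local Open Scope quotient_scope.

Definition dyadic (R : realType) (x : R) : Prop :=
  exists (m : int) (k : nat), x = m%:~R / 2 ^+ k.

(* Piecewise linear homeomorphisms [0, a] -> [0, b] with finitely many
   breaking points, all of them dyadic (the list [S]), and slopes powers of 2. *)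
Definition dyadic_pl (R : realType) (a b : nat) (f : R -> R) : Prop :=
  [/\ {within `[0, a%:R], continuous f},
      set_bij `[0, a%:R] `[0, b%:R] f &
      exists2 S : seq R, (forall s, s \in S -> dyadic s) &
        forall x y, 0 <= x -> x <= y -> y <= a%:R ->
          (forall s, s \in S -> ~~ (x < s < y)) ->
          exists z : int, forall u, x <= u <= y -> f u = f x + 2 ^ z * (u - x)].

(* The set F_n. A map on [0, 1] is represented by its extension to R that is
   constant on both sides of [0, 1], so that equality of maps is Leibniz
   equality of the underlying functions. The type is empty for n = 0. *)
Record thompson (R : realType) (n : nat) := Thompson {
  thompson_fun :> R -> R;
  thompson_pl : dyadic_pl 1 n thompson_fun;
  thompson_le0 : forall x, x <= 0 -> thompson_fun x = thompson_fun 0;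
  thompson_ge1 : forall x, 1 <= x -> thompson_fun x = thompson_fun 1 }.

Section Closure.
Variable R : realType.
Implicit Types (x y s : R) (f g : R -> R).

Lemma dyadicD x y : dyadic x -> dyadic y -> dyadic (x + y).
Proof.
move=> [m [k ->]] [p [l ->]]; exists (m * 2 ^+ l + p * 2 ^+ k), (k + l)%N.
rewrite rmorphD !rmorphM !rmorphXn /= exprD.
have h2 (i : nat) : (2 ^+ i : R) != 0 by rewrite expf_neq0.
by field; rewrite !h2.
Qed.

Lemma dyadicN x : dyadic x -> dyadic (- x).
Proof. by move=> [m [k ->]]; exists (- m), k; rewrite rmorphN mulNr. Qed.

Lemma dyadicB x y : dyadic x -> dyadic y -> dyadic (x - y).
Proof. by move=> hx hy; apply: dyadicD => //; apply: dyadicN. Qed.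

Lemma dyadicZ x (z : int) : dyadic x -> dyadic (2 ^ z * x).
Proof.
move=> [m [k ->]]; case: z => i.
  exists (m * 2 ^+ i), k; rewrite rmorphM rmorphXn /= mulrA.
  by rewrite [_%:~R * _]mulrC.
exists m, (k + i.+1)%N.
rewrite NegzE -exprnN exprD; have h2 (j : nat) : (2 ^+ j : R) != 0.
  by rewrite expf_neq0.
by field; rewrite !h2.
Qed.

Lemma dyadic_nat (n : nat) : dyadic (n%:R : R).
Proof. by exists n%:Z, 0%N; rewrite expr0 divr1. Qed.

Lemma pl_ind (P : R -> R -> Prop) (a : R) (S : seq R) :
  (forall x y, 0 <= x -> x <= y -> y <= a ->
    (forall s, s \in S -> ~~ (x < s < y)) -> P x y) ->
  (forall x s y, 0 <= x -> y <= a -> s \in S -> x < s < y ->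
    P x s -> P s y -> P x y) ->
  forall x y, 0 <= x -> x <= y -> y <= a -> P x y.
Proof.
move=> P0 PS x y; have [k] := ubnP (count (fun s => x < s < y) S).
elim: k x y => // k IH x y; rewrite ltnS => hk x0 xy ya.
case: (boolP (has (fun s => x < s < y) S)) => [/hasP[s sS xsy]|hn]; last first.
  by apply: P0 => // s sS; apply: contra hn => h; apply/hasP; exists s.
have /andP[xs sy] := xsy.
have sub (p : pred R) : (forall t, p t -> x < t < y) -> ~~ p s ->
    (count p S < k)%N.
  move=> sp ps; apply: leq_trans hk.
  have sub_pq : subpred (predU p (pred1 s)) (fun t => x < t < y).
    by move=> t /= /orP[/sp//|/eqP->].
  apply: leq_trans (sub_count sub_pq S).
  have -> : count (predU p (pred1 s)) S = (count p S + count_mem s S)%N.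
    rewrite -count_predUI -[LHS]addn0; congr addn; apply/esym/eqP.
    rewrite -leqn0 leqNgt -has_count; apply/hasP => -[t _ /= /andP[pt /eqP ts]].
    by move: ps; rewrite -ts pt.
  by rewrite -[X in (X < _)%N]addn0 ltn_add2l -has_count has_pred1.
apply: (PS x s y) => //.
- apply: IH => //; first apply: sub; last 2 first.
  + exact: ltW.
  + exact: (le_trans (ltW sy)).
  + by move=> t /andP[-> ts]; apply: lt_trans sy.
  + by rewrite ltxx andbF.
- apply: IH => //; first apply: sub; last 2 first.
  + exact: (le_trans x0 (ltW xs)).
  + exact: ltW.
  + by move=> t /andP[st ->]; rewrite (lt_trans xs st).
  + by rewrite ltxx.
Qed.

Lemma pl_lt a b f : dyadic_pl a b f ->
  forall x y, 0 <= x -> x < y -> y <= a%:R -> f x < f y.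
Proof.
move=> [_ _ [S _ Sf]] x y x0 xy ya.
suff : x < y -> f x < f y by apply.
apply: (@pl_ind (fun x y => x < y -> f x < f y) a%:R S) => //; last exact: ltW.
- move=> {x y x0 xy ya}x y x0 xy ya sf xy'; have [z hz] := Sf _ _ x0 xy ya sf.
  by rewrite (hz y) ?xy ?lexx// ltrDl mulr_gt0 ?subr_gt0 ?exprz_gt0.
- move=> {x y x0 xy ya}x s y _ _ _ /andP[xs sy] h1 h2 _.
  exact: lt_trans (h1 xs) (h2 sy).
Qed.

Lemma pl_range a b f : dyadic_pl a b f ->
  forall x, 0 <= x <= a%:R -> 0 <= f x <= b%:R.
Proof.
move=> [_ [hf _ _] _] x xa.
by have := hf x; rewrite /= !in_itv /=; apply.
Qed.

Lemma pl_surj a b f : dyadic_pl a b f ->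
  forall y, 0 <= y <= b%:R -> exists2 x, 0 <= x <= a%:R & f x = y.
Proof.
move=> [_ [_ _ hf] _] y yb; have [|x] := hf y; first by rewrite /= in_itv.
by rewrite /= in_itv /= => xa <-; exists x.
Qed.

Lemma pl0 a b f : dyadic_pl a b f -> f 0 = 0.
Proof.
move=> hf; have [|x /andP[x0 xa] fx0] := pl_surj hf (y := 0).
  by rewrite lexx ler0n.
move: x0; rewrite le_eqVlt => /orP[/eqP e|x_gt0].
  by rewrite [X in f X]e.
have := pl_lt hf (lexx 0) x_gt0 xa; have := pl_range hf (x := 0).
by rewrite lexx ler0n fx0 => /(_ isT)/andP[h _] /(le_lt_trans h); rewrite ltxx.
Qed.

Lemma pl_dyadic a b f : dyadic_pl a b f ->
  forall x, 0 <= x <= a%:R -> dyadic x <-> dyadic (f x).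
Proof.
move=> hf x /andP[x0 xa]; have [_ _ [S Sd Sf]] := hf.
suff : dyadic (0 : R) -> dyadic (f 0) -> dyadic x <-> dyadic (f x).
  by apply; rewrite ?(pl0 hf); apply: (dyadic_nat 0).
apply: (@pl_ind (fun x y => dyadic x -> dyadic (f x) ->
  dyadic y <-> dyadic (f y)) a%:R S) => //.
- move=> {x x0 xa}x y x0 xy ya sf dx dfx; have [z hz] := Sf _ _ x0 xy ya sf.
  have hy : f y = f x + 2 ^ z * (y - x) by apply: hz; rewrite xy lexx.
  split=> [dy|dfy].
    by rewrite hy; apply: dyadicD => //; apply/dyadicZ/dyadicB.
  have -> : y = x + 2 ^ (- z) * (f y - f x).
    rewrite hy [f x + _]addrC addrK mulrA -expfzDr ?pnatr_eq0//.
    by rewrite addNr expr0z mul1r addrC subrK.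
  by apply: dyadicD => //; apply/dyadicZ/dyadicB.
- move=> {x x0 xa}x s y _ _ sS _ h1 h2 dx dfx.
  have ds := Sd _ sS; apply: h2 => //; exact/(h1 dx dfx).
Qed.

Lemma dyadic_pl_comp a b c g f :
  dyadic_pl a b g -> dyadic_pl b c f -> dyadic_pl a c (f \o g).
Proof.
move=> hg hf; have [cg bg [S Sd Sg]] := hg; have [cf bf [T Td Tf]] := hf.
split.
- apply/subspace_continuousP => x ax.
  have [gab _ _] := bg.
  move/subspace_continuousP: cg => /(_ x ax) cg.
  move/subspace_continuousP: cf => /(_ (g x) (gab _ ax)) cf.
  apply: (@cvg_comp _ _ _ g f _ (within `[0, b%:R] (nbhs (g x)))) => //.
  move=> P /cg; rewrite /nbhs /= /within /=.
  by apply: filterS => t ht /[dup] at_ /ht; apply; apply: gab.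
- exact: set_bij_comp bg bf.
have /choice[ginv ginvP] : forall y : R, exists x : R,
    0 <= y <= b%:R -> 0 <= x <= a%:R /\ g x = y.
  move=> y; case: (boolP (0 <= y <= b%:R)) => [hy|_]; last by exists 0.
  by have [x xa gx] := pl_surj hg hy; exists x.
exists (S ++ [seq ginv t | t <- T & 0 <= t <= b%:R]).
  move=> s; rewrite mem_cat => /orP[/Sd//|/mapP[t]].
  rewrite mem_filter => /andP[tb tT] ->; have [ga gt] := ginvP t tb.
  by apply/(pl_dyadic hg ga); rewrite gt; apply: Td.
move=> x y x0 xy ya free.
have [z hz] : exists z : int, forall u, x <= u <= y ->
    g u = g x + 2 ^ z * (u - x).
  by apply: Sg => // s sS; apply: free; rewrite mem_cat sS.
have xa := le_trans xy ya; have y0 := le_trans x0 xy.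
have gmono u v : 0 <= u -> u <= v -> v <= a%:R -> g u <= g v.
  move=> u0; rewrite le_eqVlt => /orP[/eqP ->//|uv] va.
  exact/ltW/(pl_lt hg).
have /andP[gx0 gxb] : 0 <= g x <= b%:R by apply: (pl_range hg); rewrite x0.
have /andP[gy0 gyb] : 0 <= g y <= b%:R by apply: (pl_range hg); rewrite y0.
have [w hw] : exists w : int, forall u, g x <= u <= g y ->
    f u = f (g x) + 2 ^ w * (u - g x).
  apply: Tf => //; first exact: gmono.
  move=> t tT; apply/negP => /andP[xt ty].
  have tb : 0 <= t <= b%:R.
    by rewrite (le_trans gx0 (ltW xt)) (le_trans (ltW ty) gyb).
  have [/andP[t0 ta] gt] := ginvP t tb.
  have tS : ginv t \in S ++ [seq ginv t | t <- T & 0 <= t <= b%:R].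
    by rewrite mem_cat map_f ?orbT// mem_filter tb.
  move/negP: (free _ tS); apply.
  apply/andP; split; rewrite ltNge; apply/negP => h.
    by move: xt; rewrite -gt ltNge gmono.
  by move: ty; rewrite -gt ltNge gmono.
exists (w + z) => u /andP[xu uy] /=.
rewrite hw; last by rewrite !gmono ?(le_trans uy ya) ?(le_trans x0 xu).
rewrite (hz u) ?xu// [g x + _]addrC addrK mulrA -expfzDr ?pnatr_eq0//.
Qed.

End Closure.

(* [j : 'I_n] stands for the (j+1)-st interval [j, j+1] of [0, n]; each j in J
   contributes an extra unit of slope on its interval. *)
Definition stretch (R : realType) (n : nat) (J : {set 'I_n}) (x : R) : R :=
  x + \sum_(j in J) Num.max 0 (Num.min 1 (x - j%:R)).

Variant clamp_spec (R : realType) (z : R) : R -> Prop :=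
| ClampLow of z <= 0 : clamp_spec z 0
| ClampMid of 0 <= z <= 1 : clamp_spec z z
| ClampHigh of 1 <= z : clamp_spec z 1.

Lemma clampP (R : realType) (z : R) : clamp_spec z (Num.max 0 (Num.min 1 z)).
Proof.
have [z1|z1] := leP 1 z; first by rewrite max_r//; apply: ClampHigh.
have [z0|z0] := leP 0 z; first by apply: ClampMid; rewrite z0 ltW.
by apply: ClampLow; apply: ltW.
Qed.

Section Stretch.
Variables (R : realType) (n : nat) (J : {set 'I_n}).

Lemma stretch_slope (j : 'I_n) (x : R) : j%:R <= x <= j.+1%:R ->
  stretch J x = stretch J j%:R + (if j \in J then 2 else 1) * (x - j%:R).
Proof.
rewrite -natr1 => /andP[jx xj]; rewrite /stretch.
have clamp (i : 'I_n) : Num.max 0 (Num.min 1 (x - i%:R)) =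
    Num.max 0 (Num.min 1 (j%:R - i%:R)) + (i == j)%:R * (x - j%:R).
  have [->|] := eqVneq i j.
    by rewrite mul1r; do !case: clampP => ?; lra.
  rewrite mul0r addr0 neq_ltn => /orP[ij|ji].
    have : i%:R + 1 <= j%:R :> R by rewrite natr1 ler_nat.
    by move=> h; do !case: clampP => ?; lra.
  have : j%:R + 1 <= i%:R :> R by rewrite natr1 ler_nat.
  by move=> h; do !case: clampP => ?; lra.
rewrite (eq_bigr _ (fun i _ => clamp i)) big_split /= -mulr_suml.
have -> : \sum_(i in J) (i == j)%:R = (j \in J)%:R :> R.
  case: (boolP (j \in J)) => jJ; last first.
    by apply: big1 => i iJ; case: eqP => // ij; rewrite ij (negbTE jJ) in iJ.
  by rewrite (bigD1 j)//= eqxx big1 ?addr0// => i /andP[_ /negbTE ->].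
by case: (j \in J); rewrite ?mulr1n ?mulr0n; ring.
Qed.

Lemma stretch0 : stretch J (0 : R) = 0.
Proof.
rewrite /stretch big1 ?addr0// => j _.
by have := ler0n R j; case: clampP => ?; lra.
Qed.

Lemma stretchn : stretch J (n%:R : R) = (n + #|J|)%:R.
Proof.
rewrite /stretch natrD -sumr_const; congr +%R; apply: eq_bigr => j _.
have : j%:R + 1 <= n%:R :> R by rewrite natr1 ler_nat.
by case: clampP => ?; lra.
Qed.

Lemma stretch_lt (x y : R) : x < y -> stretch J x < stretch J y.
Proof.
move=> xy; apply: ltr_leD => //; apply: ler_sum => j _.
by do !case: clampP => ?; lra.
Qed.

Lemma stretch_continuous : continuous (stretch J : R -> R).
Proof.
move=> x; apply: cvgD; first exact: cvg_id.
apply: cvg_big => [|j _]; first exact: add_continuous.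
have c : {for x, continuous (fun y : R => y - j%:R)}.
  by apply: cvgB; [exact: cvg_id|exact: cvg_cst].
apply: (@continuous_max _ _ (cst 0) _ x); first exact: cvg_cst.
by apply: (@continuous_min _ _ (cst 1) _ x); first exact: cvg_cst.
Qed.

Lemma stretch_pl : dyadic_pl n (n + #|J|) (stretch J : R -> R).
Proof.
have cs : {within `[0, n%:R], continuous (stretch J : R -> R)}.
  exact/continuous_subspaceT/stretch_continuous.
have smono (x y : R) : x <= y -> stretch J x <= stretch J y.
  by rewrite le_eqVlt => /orP[/eqP ->//|/stretch_lt/ltW].
split=> //.
- split.
  + move=> x; rewrite /= !in_itv /= => /andP[x0 xn].
    by rewrite -stretch0 -stretchn !smono.
  + move=> x y _ _ sxy; apply/eqP; rewrite eq_le !leNgt.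
    by apply/andP; split; apply/negP => /stretch_lt; rewrite sxy ltxx.
  + move=> y; rewrite /= in_itv /= => yb.
    have [||c] := @IVT R (stretch J) 0 n%:R y _ cs.
    * exact: ler0n.
    * by rewrite stretch0 stretchn min_l ?max_r ?ler0n.
    * by rewrite in_itv /= => cn <-; exists c => //; rewrite /= in_itv.
exists [seq i%:R | i <- iota 0 n.+1] => [s /mapP[i _ ->]|x y x0 xy yn free].
  exact: dyadic_nat.
have [xn|nx] := ltP x n%:R; last first.
  exists 0 => u /andP[xu uy]; have -> : u = x by lra.
  by rewrite subrr mulr0 addr0.
pose j := Num.truncn x.
have /andP[jx xj] : j%:R <= x < j.+1%:R by apply: truncn_itv.
have jn : (j < n)%N by rewrite -(ltr_nat R) (le_lt_trans jx).
have yj : y <= j.+1%:R.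
  rewrite leNgt; apply/negP => jy; have jS : j.+1%:R \in [seq i%:R : R | i <- iota 0 n.+1].
    by apply: map_f; rewrite mem_iota /= add0n ltnS.
  move/negP: (free _ jS); apply.
  by rewrite xj jy.
exists (Posz (Ordinal jn \in J)) => u /andP[xu uy].
rewrite (@stretch_slope (Ordinal jn) u) /=; last first.
  by rewrite (le_trans jx xu) (le_trans uy yj).
rewrite (@stretch_slope (Ordinal jn) x) /=; last by rewrite jx ltW.
by case: (_ \in J); rewrite ?expr1z ?expr0z; ring.
Qed.

End Stretch.

Section Constructions.
Variable R : realType.

Lemma thompson_comp_pl (n : nat) (x : thompson R n) (g : thompson R 1) :
  dyadic_pl 1 n (x \o g).
Proof. exact: dyadic_pl_comp (thompson_pl g) (thompson_pl x). Qed.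

Definition thompson_comp (n : nat) (x : thompson R n) (g : thompson R 1) :
  thompson R n :=
  @Thompson R n (x \o g) (thompson_comp_pl x g)
    (fun t t0 => congr1 x (thompson_le0 g t0))
    (fun t t1 => congr1 x (thompson_ge1 g t1)).

Lemma bracket_pl (n : nat) (g : thompson R n) (J : {set 'I_n}) :
  dyadic_pl 1 (n + #|J|) (stretch J \o g).
Proof. exact: dyadic_pl_comp (thompson_pl g) (stretch_pl R J). Qed.

Definition bracket (n : nat) (g : thompson R n) (J : {set 'I_n}) :
  thompson R (n + #|J|) :=
  @Thompson R (n + #|J|) (stretch J \o g) (bracket_pl g J)
    (fun t t0 => congr1 (stretch J) (thompson_le0 g t0))
    (fun t t1 => congr1 (stretch J) (thompson_ge1 g t1)).

End Constructions.

Record unit_cube (R : realType) (n : nat) := UnitCube {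
  cube_coord :> 'rV[R]_n;
  cube_coordP : forall i, 0 <= cube_coord 0 i <= 1 }.

Definition chi (R : realType) (n : nat) (I : {set 'I_n}) : 'rV[R]_n :=
  \row_i (i \in I)%:R.

(* The face of [0,1]^n whose vertices are the chi I with J <= I <= K. *)
Definition face (R : realType) (n : nat) (J K : {set 'I_n}) : set 'rV[R]_n :=
  [set t | forall i, [/\ 0 <= t 0 i <= 1,
                         i \in J -> t 0 i = 1 & i \notin K -> t 0 i = 0]].

(* phi identifies the face (J, K) of C(f) with the face (J', K') of C(h),
   matching the labels of the vertices. *)
Definition face_gluing (R : realType) (n m : nat)
    (f : thompson R n) (J K : {set 'I_n})
    (h : thompson R m) (J' K' : {set 'I_m}) (phi : 'rV[R]_n -> 'rV[R]_m) : Prop :=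
  [/\ J \subset K, J' \subset K',
      exists (A : 'M[R]_(n, m)) (b : 'rV[R]_m), forall v, phi v = v *m A + b,
      set_bij (face J K) (face J' K') phi &
      forall I : {set 'I_n}, J \subset I -> I \subset K ->
        exists I' : {set 'I_m}, [/\ J' \subset I', I' \subset K', phi (chi R I) = chi R I' &
                       bracket f I = bracket h I' :> (R -> R)]].

(* Points of the disjoint union of the cubes C(g), g in F_oo. *)
Record cube_point (R : realType) := CubePoint {
  cp_dim : nat;
  cp_cube : thompson R cp_dim;
  cp_coord : unit_cube R cp_dim }.

HB.instance Definition _ (R : realType) := gen_eqMixin (cube_point R).
HB.instance Definition _ (R : realType) := gen_choiceMixin (cube_point R).

Definition glue (R : realType) (p q : cube_point R) : Prop :=
  exists J K J' K' phi,
    [/\ face_gluing (cp_cube p) J K (cp_cube q) J' K' phi,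
        face J K (cp_coord p) & phi (cp_coord p) = cp_coord q].

Definition glue_eq (R : realType) : rel (cube_point R) :=
  fun p q => `[< clos_refl_sym_trans _ (@glue R) p q >].

Section GlueEquiv.
Variable R : realType.

Lemma glue_eq_refl : reflexive (@glue_eq R).
Proof. by move=> p; apply/asboolP; apply: rst_refl. Qed.

Lemma glue_eq_sym : symmetric (@glue_eq R).
Proof.
by move=> p q; apply/asboolP/asboolP => h; apply: rst_sym.
Qed.

Lemma glue_eq_trans : transitive (@glue_eq R).
Proof.
move=> q p r /asboolP h1 /asboolP h2; apply/asboolP; exact: rst_trans h1 h2.
Qed.

Canonical glue_equiv := EquivRel (@glue_eq R)
  glue_eq_refl glue_eq_sym glue_eq_trans.

End GlueEquiv.

Definition X (R : realType) : Type := {eq_quot (@glue_equiv R)}.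

Definition to_X (R : realType) (p : cube_point R) : X R :=
  \pi_({eq_quot (@glue_equiv R)}) p.

Definition rep_X (R : realType) (x : X R) : cube_point R :=
  repr (x : {eq_quot (@glue_equiv R)}).

Definition cube_dist (R : realType) (n : nat) (t u : 'rV[R]_n) : R :=
  Num.sqrt (\sum_i (t 0 i - u 0 i) ^+ 2).

(* [chain x y l]: there is a finite string of points from x to y, consecutive
   ones being joined by a Euclidean segment inside a cube, of total length l. *)
Inductive chain (R : realType) (x : X R) : X R -> R -> Prop :=
| chain_refl : chain x x 0
| chain_step (y : X R) (l : R) (n : nat) (f : thompson R n) (t u : unit_cube R n) :
    chain x y l -> y = to_X (CubePoint f t) ->
    chain x (to_X (CubePoint f u)) (l + cube_dist t u).

(* The length metric of the cubical complex: the infimum of the lengths of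
   piecewise geodesic strings. *)
Definition distX (R : realType) (x y : X R) : R := inf [set l | chain x y l].

Definition act_point (R : realType) (g : thompson R 1) (p : cube_point R) :
  cube_point R := CubePoint (thompson_comp (cp_cube p) g) (cp_coord p).

(* The map C(x) -> C(x \o g) with the same coordinates; it is compatible with
   the gluing by [act_to_X] below, hence independent of the representative. *)
Definition act (R : realType) (g : thompson R 1) (x : X R) : X R :=
  to_X (act_point g (rep_X x)).

Lemma act_to_X (R : realType) (g : thompson R 1) (p : cube_point R) :
  act g (to_X p) = to_X (act_point g p).
Proof.
have compat q r : glue q r -> glue (act_point g q) (act_point g r).
  move=> [J [K [J' [K' [phi [[h1 h2 h3 h4 h5] h6 h7]]]]]].
  exists J, K, J', K', phi; split=> //; split=> // I JI IK.
  have [I' [? ? ? e]] := h5 I JI IK; exists I'; split=> //.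
  by apply: funext => t; have := congr1 (@^~ (g t)) e.
rewrite /act /to_X /rep_X; apply/eqmodP/asboolP.
have /eqmodP/asboolP : repr (\pi_({eq_quot (@glue_equiv R)}) p) = p
    %[mod {eq_quot (@glue_equiv R)}] by rewrite reprK.
move: (repr _) => p'; elim=> [q r /compat|q|q r _|q r s _ + _ +].
- exact: rst_step.
- exact: rst_refl.
- exact: rst_sym.
- move=> h1 h2; exact: rst_trans h1 h2.
Qed.

Definition isometryX (R : realType) (phi : X R -> X R) : Prop :=
  bijective phi /\ forall x y, distX (phi x) (phi y) = distX x y.

Definition translation_length (R : realType) (phi : X R -> X R) : R :=
  inf [set distX (phi x) x | x in [set: X R]].

Definition parabolic (R : realType) (phi : X R -> X R) : Prop :=
  isometryX phi /\ ~ exists x, distX (phi x) x = translation_length phi.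

Definition irreducible (R : realType) (g : thompson R 1) : Prop :=
  [set x : R | 0 <= x <= 1 /\ g x = x] = [set 0; 1].

Definition right_derivative (R : realType) (f : R -> R) (a : R) : R :=
  lim ((f x - f a) / (x - a) @[x --> a^'+]).

Definition left_derivative (R : realType) (f : R -> R) (a : R) : R :=
  lim ((f x - f a) / (x - a) @[x --> a^'-]).

Definition log2 (R : realType) (x : R) : R := ln x / ln 2.

(* Main.v *)
From HB Require Import structures.
From Stdlib Require Import Relation_Operators.
Require Import Defs.
From mathcomp Require Import all_boot all_order all_algebra generic_quotient.
From mathcomp Require Import all_classical all_reals all_analysis.
From mathcomp Require Import zify ring lra.
Import Order.TTheory GRing.Theory Num.Theory.
Import numFieldNormedType.Exports.

(* Write a and b for the base 2 logarithms of g'(0) and g'(1).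

   Lower bound: the function Psi, affine on cubes, with coefficient alpha on the
   first coordinate, beta on the last one and gamma on the others, is well
   defined on X; it is Lipschitz with constant
   sqrt(alpha^2 + beta^2 + n gamma^2) on n-dimensional cubes, and g translates it
   by (alpha - gamma) a + (beta - gamma) b. Taking (alpha, beta, gamma) =
   (a, b, 0) gives d(gx, x) >= sqrt(a^2 + b^2). If a + b <> 0, then
   (a, b, -(a + b)/N) gives a strictly larger bound for the paths that only meet
   cubes of dimension at most N; along a path from x, the square root of
   n + sum of the coordinates (the case alpha = beta = gamma = 1) grows at most
   at speed 1/2, so N is bounded in terms of x and of the length.

   Upper bound: up to replacing g by its inverse, g moves points to the right.
   Near 0 and near 1 it is linear, and the subdivisions by the points 2^-k and
   1 - 2^-k are invariant under g up to a, respectively -b, subdivisions of the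
   extreme interval. They are connected, through a third g-invariant subdivision
   in the middle, by passages that are spread over many fundamental domains of g:
   M steps of length 1/M in orthogonal directions have total length M^(-1/2).
   This produces x with d(gx, x)^2 as close to a^2 + b^2 as desired. *)

Set Implicit Arguments.
Unset Strict Implicit.
Unset Printing Implicit Defensive.

Local Open Scope ring_scope.

(** * Subdivisions of an interval into pieces of dyadic lengths *)

Section Lists.
Variable R : realType.
Local Open Scope classical_set_scope.
Implicit Types (p u v x y z : R) (d : nat) (ds : seq nat).

Definition piece d p u : R := Num.max 0 (Num.min 1 (2 ^+ d * (u - p))).

(** As a sum of clamped ramps, the map that sends the successive intervals of lengths [2^-d] from
    [p] on to consecutive unit intervals is defined and monotone on the whole line and constant
    outside the subdivided interval. *)
Fixpoint plf p ds u : R :=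
  if ds is d :: ds' then piece d p u + plf (p + 2 ^- d) ds' u else 0.

Definition tot ds : R := \sum_(d <- ds) 2 ^- d.

Lemma exp2_gt0 d : (0 : R) < 2 ^+ d. Proof. by rewrite exprn_gt0. Qed.
Lemma exp2V_gt0 d : (0 : R) < 2 ^- d. Proof. by rewrite invr_gt0 exp2_gt0. Qed.
Lemma exp2K d : (2 ^+ d : R) * 2 ^- d = 1.
Proof. by rewrite divff// gt_eqF// exp2_gt0. Qed.

Lemma exp2VS d : 2 ^- d = 2 ^- d.+1 + 2 ^- d.+1 :> R.
Proof. by rewrite exprS invfM; field; rewrite expf_neq0. Qed.

Lemma piece_low d p u : u <= p -> piece d p u = 0.
Proof.
move=> up; have : 2 ^+ d * (u - p) <= 0.
  by rewrite mulr_ge0_le0 ?subr_le0// ltW// exp2_gt0.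
by rewrite /piece; case: clampP => *; lra.
Qed.

Lemma piece_mid d p u : p <= u <= p + 2 ^- d -> piece d p u = 2 ^+ d * (u - p).
Proof.
move=> /andP[pu up]; have h0 : 0 <= 2 ^+ d * (u - p).
  by rewrite mulr_ge0 ?subr_ge0// ltW// exp2_gt0.
have h1 : 2 ^+ d * (u - p) <= 1.
  by rewrite -[leRHS](exp2K d) ler_pM2l ?exp2_gt0//; lra.
by rewrite /piece; case: clampP => *; lra.
Qed.

Lemma piece_high d p u : p + 2 ^- d <= u -> piece d p u = 1.
Proof.
move=> up; have : 1 <= 2 ^+ d * (u - p).
  by rewrite -[leLHS](exp2K d) ler_pM2l ?exp2_gt0//; lra.
by rewrite /piece; case: clampP => *; lra.
Qed.

Lemma piece_le d p u v : u <= v -> piece d p u <= piece d p v.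
Proof.
move=> uv; have : 2 ^+ d * (u - p) <= 2 ^+ d * (v - p).
  by rewrite ler_pM2l ?exp2_gt0//; lra.
by rewrite /piece; do 2!case: clampP => ?; lra.
Qed.

Lemma piece_range d p u : 0 <= piece d p u <= 1.
Proof. by rewrite /piece; case: clampP => ?; lra. Qed.

Lemma tot_nil : tot [::] = 0. Proof. by rewrite /tot big_nil. Qed.
Lemma tot_cons d ds : tot (d :: ds) = 2 ^- d + tot ds.
Proof. by rewrite /tot big_cons. Qed.
Lemma tot_cat ds ds' : tot (ds ++ ds') = tot ds + tot ds'.
Proof. by rewrite /tot big_cat. Qed.
Lemma tot_ge0 ds : 0 <= tot ds.
Proof. by apply: sumr_ge0 => d _; rewrite ltW// exp2V_gt0. Qed.

Lemma plf_cat p ds ds' u :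
  plf p (ds ++ ds') u = plf p ds u + plf (p + tot ds) ds' u.
Proof.
elim: ds p => [|d ds IH] p /=; first by rewrite tot_nil addr0 add0r.
by rewrite IH tot_cons !addrA.
Qed.

Lemma plf_low p ds u : u <= p -> plf p ds u = 0.
Proof.
elim: ds p => //= d ds IH p up; rewrite piece_low// IH ?addr0//.
by have := exp2V_gt0 d; lra.
Qed.

Lemma plf_high p ds u : p + tot ds <= u -> plf p ds u = (size ds)%:R.
Proof.
elim: ds p => //= d ds IH p; rewrite tot_cons addrA => up.
have t0 := tot_ge0 ds; rewrite IH// piece_high; last by lra.
by rewrite -natr1 addrC.
Qed.

Lemma plf_le p ds u v : u <= v -> plf p ds u <= plf p ds v.
Proof. by move=> uv; elim: ds p => //= d ds IH p; rewrite lerD// piece_le. Qed.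

Lemma plf_range p ds u : 0 <= plf p ds u <= (size ds)%:R.
Proof.
elim: ds p => [|d ds IH] p /=; first by rewrite lexx.
by have := IH (p + 2 ^- d); have := piece_range d p u; rewrite -natr1; lra.
Qed.

Lemma plf_lt p ds u v : p <= u -> u < v -> v <= p + tot ds ->
  plf p ds u < plf p ds v.
Proof.
elim: ds p => [|d ds IH] p /=; first by rewrite tot_nil; lra.
rewrite tot_cons addrA => pu uv vp.
have [up|pu'] := ltP u (p + 2 ^- d).
  apply: ltr_leD; last exact: plf_le (ltW uv).
  rewrite (piece_mid (u := u)) ?pu ?ltW//.
  have [vp'|pv'] := leP v (p + 2 ^- d).
    by rewrite piece_mid ?ltr_pM2l ?exp2_gt0//; lra.
  rewrite piece_high ?ltW// -[ltRHS](exp2K d) ltr_pM2l ?exp2_gt0//; lra.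
by apply: ler_ltD; [exact: piece_le (ltW uv)|exact: IH].
Qed.

Fixpoint posn p ds : seq R :=
  if ds is d :: ds' then p + 2 ^- d :: posn (p + 2 ^- d) ds' else [::].

Lemma plf_affine p ds x y : p <= x -> x <= y -> y <= p + tot ds ->
  (forall s, s \in posn p ds -> ~~ (x < s < y)) ->
  exists z : int, forall u, x <= u <= y ->
    plf p ds u = plf p ds x + 2 ^ z * (u - x).
Proof.
elim: ds p => [|d ds IH] p /=.
  rewrite tot_nil => px xy yp _; exists 0 => u xuy.
  have -> : u = x by lra.
  by rewrite subrr mulr0 addr0.
rewrite tot_cons addrA => px xy yp free.
have [yp'|py] := leP y (p + 2 ^- d).
  exists d%:Z => u /andP[xu uy].
  rewrite !piece_mid ?plf_low -?exprnP; try lra.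
have px' : p + 2 ^- d <= x.
  rewrite leNgt; apply/negP => h.
  by have := free _ (mem_head _ _); rewrite h py.
have [|z hz] := IH (p + 2 ^- d) px' xy yp.
  by move=> s sS; apply: free; rewrite inE sS orbT.
exists z => u xuy; rewrite hz// !piece_high; lra.
Qed.

Lemma piece_continuous d p : continuous (piece d p).
Proof.
move=> x; apply: (@continuous_max _ _ (cst 0) _ x); first exact: cvg_cst.
apply: (@continuous_min _ _ (cst 1) _ x); first exact: cvg_cst.
apply: (@cvgM _ _ _ _ (cst (2 ^+ d)) (fun y : R => y - p)); first exact: cvg_cst.
by apply: cvgB; [exact: cvg_id|exact: cvg_cst].
Qed.

Lemma plf_continuous p ds : continuous (plf p ds).
Proof.
elim: ds p => [|d ds IH] p x /=; first exact: cvg_cst.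
by apply: cvgD; [exact: piece_continuous|exact: IH].
Qed.

Lemma dyadic_exp2V d : dyadic (2 ^- d : R).
Proof. by exists 1, d; rewrite mulr1z mul1r. Qed.

Lemma plf_pl ds : tot ds = 1 -> dyadic_pl 1 (size ds) (plf 0 ds).
Proof.
move=> t1; have cs : {within `[0, 1%:R], continuous (plf 0 ds)}.
  exact/continuous_subspaceT/plf_continuous.
have l0 : plf 0 ds 0 = 0 by rewrite plf_low.
have l1 : plf 0 ds 1%:R = (size ds)%:R by rewrite plf_high// t1 add0r.
split=> //.
- split.
  + by move=> x _; rewrite /= in_itv /=; apply: plf_range.
  + move=> x y; rewrite !inE /= !in_itv /= => /andP[x0 x1] /andP[y0 y1] e.
    case: (ltgtP x y) => // xy.
      by have := @plf_lt 0 ds _ _ x0 xy; rewrite t1 add0r e ltxx => /(_ y1).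
    by have := @plf_lt 0 ds _ _ y0 xy; rewrite t1 add0r e ltxx => /(_ x1).
  + move=> y; rewrite /= in_itv /= => yb.
    have [||c] := @IVT R (plf 0 ds) 0 1%:R y _ cs; first exact: ler0n.
      by rewrite l0 l1 min_l ?max_r ?ler0n.
    by rewrite in_itv /= => cn <-; exists c => //; rewrite /= in_itv.
exists (posn 0 ds) => [s|x y x0 xy yn free].
  have : dyadic (0 : R) by exact: (dyadic_nat R 0).
  elim: (ds) (0 : R) => //= d ds' IH p dp; rewrite inE => /orP[/eqP->|].
    by apply: dyadicD => //; apply: dyadic_exp2V.
  by apply: IH; apply: dyadicD => //; apply: dyadic_exp2V.
by apply: plf_affine => //; rewrite t1 add0r.
Qed.

Lemma plf_le0 ds u : u <= 0 -> plf 0 ds u = plf 0 ds 0.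
Proof. by move=> u0; rewrite !plf_low. Qed.

Lemma plf_ge1 ds u : tot ds = 1 -> 1 <= u -> plf 0 ds u = plf 0 ds 1.
Proof. by move=> t1 u1; rewrite !plf_high ?t1 ?add0r. Qed.

Definition vert ds (t1 : tot ds = 1) : thompson R (size ds) :=
  Thompson (plf_pl t1) (@plf_le0 ds) (fun u => plf_ge1 t1).

(* [f] maps the consecutive intervals of lengths [2^-d], [d] in [ds'], starting
   at [p'], affinely onto those given by [ds] and [p]. *)
Fixpoint carries (f : R -> R) p' (ds' : seq nat) p ds : Prop :=
  match ds', ds with
  | [::], [::] => f p' = p
  | d' :: ds', d :: ds =>
      (forall s, 0 <= s <= 2 ^- d' -> f (p' + s) = p + 2 ^+ d' / 2 ^+ d * s) /\
      carries f (p' + 2 ^- d') ds' (p + 2 ^- d) ds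
  | _, _ => False
  end.

Lemma carries_size f p' ds' p ds : carries f p' ds' p ds -> size ds' = size ds.
Proof.
by elim: ds' p' p ds => [|d' ds' IH] p' p [|d ds]//= [_ /IH ->].
Qed.

Lemma carries_ge f p' ds' p ds u : carries f p' ds' p ds ->
  p' <= u <= p' + tot ds' -> p <= f u.
Proof.
elim: ds' p' p ds => [|d' ds' IH] p' p [|d ds]//=.
  by rewrite tot_nil => <- hu; have -> : u = p' by lra.
rewrite tot_cons addrA => -[h c'] /andP[pu up].
have [up'|pu'] := leP u (p' + 2 ^- d').
  have -> : u = p' + (u - p') by lra.
  rewrite h; last by lra.
  by rewrite lerDl mulr_ge0 ?divr_ge0 ?exprn_ge0// subr_ge0.
have e0 := exp2V_gt0 d; have := IH _ _ _ c'; rewrite ltW//= up => /(_ isT); lra.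
Qed.

(** Precomposition with [f] pulls the subdivision [ds] back to [ds']. This turns the action of [g]
    on vertices into an operation on lists of depths. *)
Lemma carries_plf f p' ds' p ds u : carries f p' ds' p ds ->
  p' <= u <= p' + tot ds' -> plf p ds (f u) = plf p' ds' u.
Proof.
elim: ds' p' p ds => [|d' ds' IH] p' p [|d ds]//=.
rewrite tot_cons addrA => -[h c] /andP[pu up].
have [up'|pu'] := leP u (p' + 2 ^- d').
  have fu : f u = p + 2 ^+ d' / 2 ^+ d * (u - p').
    by rewrite -h; [congr f|]; lra.
  have fu1 : f u - p = 2 ^+ d' / 2 ^+ d * (u - p') by rewrite fu; lra.
  have pfu : p <= f u.
    by rewrite -subr_ge0 fu1 mulr_ge0 ?divr_ge0 ?subr_ge0// ltW// exp2_gt0.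
  have fup : f u <= p + 2 ^- d.
    rewrite fu lerD2l mulrAC ler_piMl ?(ltW (exp2V_gt0 d))//.
    by rewrite -[leRHS](exp2K d') ler_pM2l ?exp2_gt0//; lra.
  rewrite !piece_mid ?pfu ?fup ?pu ?up'// !plf_low// !addr0 fu1.
  by rewrite mulrA mulrCA divff ?mulr1// gt_eqF// exp2_gt0.
have u_rest : p' + 2 ^- d' <= u <= p' + 2 ^- d' + tot ds' by rewrite ltW.
by rewrite !piece_high ?(ltW pu') ?(IH _ _ _ c)// (carries_ge c).
Qed.

Lemma carries_cat f p' ds' p ds es' es : carries f p' ds' p ds ->
  carries f (p' + tot ds') es' (p + tot ds) es ->
  carries f p' (ds' ++ es') p (ds ++ es).
Proof.
elim: ds' p' p ds => [|d' ds' IH] p' p [|d ds]//=.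
  by rewrite !tot_nil !addr0.
by rewrite !tot_cons !addrA => -[h c] /(IH _ _ _ c); split.
Qed.

(** Used for the germ of [g] at 0: pulling back by a map of slope [2^a] raises all depths by [a].
    The next lemma serves for the contracting germ at 1. *)
Lemma carries_scale_dn f p' p (a : nat) ds :
  (forall s, 0 <= s <= tot (map (addn a) ds) -> f (p' + s) = p + 2 ^+ a * s) ->
  carries f p' (map (addn a) ds) p ds.
Proof.
elim: ds p' p => [|d ds IH] p' p /=.
  rewrite tot_nil => /(_ 0); rewrite mulr0 !addr0; apply; lra.
have ta := tot_ge0 (map (addn a) ds); have ea := exp2V_gt0 (a + d).
rewrite tot_cons => h; split.
  move=> s /andP[s0 s1]; rewrite h; last by lra.
  by rewrite exprD mulfK// gt_eqF// exp2_gt0.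
apply: IH => s hs; rewrite -addrA h; last by lra.
rewrite mulrDr addrA; congr (_ + _ + _).
by rewrite exprD invfM mulrA divff ?mul1r// gt_eqF// exp2_gt0.
Qed.

Lemma carries_scale_up f p' p (b : nat) ds :
  (forall s, 0 <= s <= tot ds -> f (p' + s) = p + 2 ^- b * s) ->
  carries f p' ds p (map (addn b) ds).
Proof.
elim: ds p' p => [|d ds IH] p' p /=.
  rewrite tot_nil => /(_ 0); rewrite mulr0 !addr0; apply; lra.
have ta := tot_ge0 ds; have ea := exp2V_gt0 d.
rewrite tot_cons => h; split.
  move=> s /andP[s0 s1]; rewrite h; last by lra.
  by rewrite exprD invfM [2 ^- b / _]mulrC mulrA divff ?mul1r// gt_eqF// exp2_gt0.
apply: IH => s hs; rewrite -addrA h; last by lra.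
by rewrite mulrDr addrA exprD invfM.
Qed.

(** Doubling the slope over the unit interval [j] amounts to halving the corresponding piece, so
    that the passage from [g] to [g[{j}]] is one subdivision. *)
Lemma stretch_plf (A B : seq nat) d (j : 'I_(size (A ++ d :: B))) p u :
  j = size A :> nat ->
  stretch [set j] (plf p (A ++ d :: B) u) = plf p (A ++ d.+1 :: d.+1 :: B) u.
Proof.
move=> jA; rewrite /stretch big_set1 !plf_cat /= jA.
set q := p + tot A.
have -> : q + 2 ^- d.+1 + 2 ^- d.+1 = q + 2 ^- d by rewrite [in RHS]exp2VS addrA.
have -> : piece d.+1 q u + (piece d.+1 (q + 2 ^- d.+1) u + plf (q + 2 ^- d) B u)
   = piece d q u + piece d q u + plf (q + 2 ^- d) B u.
  rewrite addrA; congr (_ + _).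
  have hh := exp2VS d; have h1 := exp2V_gt0 d.+1; have e2 := exprS (2:R) d.
  have k1 := exp2K d.+1.
  have [uq|qu] := leP u q.
    by rewrite !piece_low//; lra.
  have [uh|hu] := leP u (q + 2 ^- d.+1).
    rewrite (@piece_low d.+1 (q + _))// !piece_mid; try lra.
    by rewrite exprS; ring.
  have [ud|du] := leP u (q + 2 ^- d); last by rewrite !piece_high; lra.
  rewrite (@piece_high d.+1 q) ?ltW// !piece_mid; try lra.
  by rewrite opprD addrA mulrBr k1 exprS; ring.
have h1 := plf_range p A u; have h2 := plf_range (q + 2 ^- d) B u.
have h3 := piece_range d q u; have h4 := exp2V_gt0 d.
(* The clamp isolates the piece [d]: left of it the whole sum is at most [size A], right of it at
   least [size A + 1]. *)
have -> : Num.max 0 (Num.min 1 (plf p A u + (piece d q u + plf (q + 2 ^- d) B u) -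
    (size A)%:R)) = piece d q u.
  have [uq|qu] := leP u q.
    by rewrite (@piece_low d q)// (@plf_low _ B); [case: clampP => ?|]; lra.
  have -> : plf p A u = (size A)%:R by rewrite plf_high// ltW.
  have [ud|du] := leP u (q + 2 ^- d); last by rewrite piece_high; [case: clampP => ?|]; lra.
  by rewrite (@plf_low _ B)//; case: clampP => ?; lra.
lra.
Qed.

End Lists.

(** * Piecewise linear maps: germs at the end points, inverses *)

Section PiecewiseLinear.
Variable R : realType.
Local Open Scope classical_set_scope.
Implicit Types (f g h : R -> R) (x y u v : R) (a b n k i : nat) (z : int).

Lemma exp2z_gt0 z : (0 : R) < 2 ^ z. Proof. by rewrite exprz_gt0. Qed.

Lemma exp2z_inj : injective (exprz (2 : R)).
Proof. by apply: ieexprIz => //; rewrite eq_sym lt_eqF// ltr1n. Qed.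

Lemma exp2zD z w : 2 ^ (z + w) = 2 ^ z * 2 ^ w :> R.
Proof. by rewrite expfzDr ?pnatr_eq0. Qed.

Lemma exp2zK z : 2 ^ z * 2 ^ (- z) = 1 :> R.
Proof. by rewrite -exp2zD subrr expr0z. Qed.

Lemma thompson_eq n (f h : thompson R n) : f = h :> (R -> R) -> f = h.
Proof.
case: f h => [f f1 f2 f3] [h h1 h2 h3] /= e; case: _ / e h1 h2 h3 => h1 h2 h3.
by congr Thompson; apply: Prop_irrelevance.
Qed.

Lemma dyadic_common (S : seq R) : (forall s, s \in S -> dyadic s) ->
  exists k0, forall k, (k0 <= k)%N -> forall s, s \in S ->
    exists m : int, s * 2 ^+ k = m%:~R.
Proof.
elim: S => [|s S IH] dS; first by exists 0%N.
have [k1 h1] : exists k0, forall k, (k0 <= k)%N -> forall s, s \in S ->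
    exists m : int, s * 2 ^+ k = m%:~R.
  by apply: IH => t tS; apply: dS; rewrite inE tS orbT.
have [m [l sE]] := dS s (mem_head _ _).
exists (maxn l k1) => k; rewrite geq_max => /andP[lk k1k] t.
rewrite inE => /orP[/eqP->|]; last exact: h1.
exists (m * 2 ^+ (k - l)); rewrite sE -{1}(subnK lk) exprD rmorphM rmorphXn /=.
by field; rewrite expf_neq0.
Qed.

Lemma grid_free k (m : int) i x :
  x * 2 ^+ k = m%:~R -> ~~ (i%:R / 2 ^+ k < x < i.+1%:R / 2 ^+ k).
Proof.
move=> xm; rewrite ltr_pdivrMr ?exp2_gt0// ltr_pdivlMr ?exp2_gt0// xm.
rewrite -[i%:R]/((Posz i)%:~R) -[i.+1%:R]/((Posz i.+1)%:~R) !ltr_int.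
apply/negP; lia.
Qed.

(** For large [k] all breaking points lie on the grid of mesh [2^-k]. Allowing every [k >= k0] makes
    it possible to meet several such requirements at once. *)
Lemma pl_fine a b f : dyadic_pl a b f ->
  exists k0, forall k, (k0 <= k)%N -> forall i, (i < a * 2 ^ k)%N ->
  exists z, forall s, 0 <= s <= 2 ^- k ->
    f (i%:R / 2 ^+ k + s) = f (i%:R / 2 ^+ k) + 2 ^ z * s.
Proof.
move=> [_ _ [S dS hS]]; have [k0 hk0] := dyadic_common dS.
exists k0 => k kk i ia; have e2 := exp2_gt0 R k.
have iS : i.+1%:R / 2 ^+ k = i%:R / 2 ^+ k + 2 ^- k :> R.
  by rewrite -natr1 mulrDl mul1r.
have ei := exp2V_gt0 R k.
have [||||z hz] := hS (i%:R / 2 ^+ k) (i.+1%:R / 2 ^+ k).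
- by rewrite divr_ge0 ?(ltW e2).
- by rewrite iS; lra.
- by rewrite ler_pdivrMr// -natrX -natrM ler_nat.
- by move=> s sS; have [m hm] := hk0 _ kk _ sS; apply: grid_free hm.
exists z => s /andP[s0 s1]; rewrite hz; last by rewrite iS; lra.
by congr (_ + _ * _); lra.
Qed.

Definition germ0 f z :=
  exists2 e : R, 0 < e & forall u, 0 <= u <= e -> f u = 2 ^ z * u.
Definition germ1 f z :=
  exists2 e : R, 0 < e & forall u, 0 <= u <= e -> f (1 - u) = f 1 - 2 ^ z * u.

(** The exponent of the slope at 0; for elements of [F_n] the default value of [xget] does not
    arise, by [germ0_slope0]. The same holds for [slope1] at the other end. *)
Definition slope0 f : int := xget 0 (germ0 f).
Definition slope1 f : int := xget 0 (germ1 f).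

Lemma germ0_uniq f z w : germ0 f z -> germ0 f w -> z = w.
Proof.
move=> [e e0 he] [d d0 hd]; apply: exp2z_inj.
have m0 : 0 < Num.min e d by rewrite lt_min e0.
apply: (mulIf (lt0r_neq0 m0)); rewrite -he -?hd//.
  by rewrite ltW//= ge_min lexx orbT.
by rewrite ltW//= ge_min lexx.
Qed.

Lemma germ1_uniq f z w : germ1 f z -> germ1 f w -> z = w.
Proof.
move=> [e e0 he] [d d0 hd]; apply: exp2z_inj.
have m0 : 0 < Num.min e d by rewrite lt_min e0.
apply: (mulIf (lt0r_neq0 m0)); apply/oppr_inj/(addrI (f 1)); rewrite -he -?hd//.
  by rewrite ltW//= ge_min lexx orbT.
by rewrite ltW//= ge_min lexx.
Qed.

Lemma slope0E f z : germ0 f z -> slope0 f = z.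
Proof. by move=> hz; apply: (germ0_uniq _ hz); apply: xgetPex; exists z. Qed.

Lemma slope1E f z : germ1 f z -> slope1 f = z.
Proof. by move=> hz; apply: (germ1_uniq _ hz); apply: xgetPex; exists z. Qed.

Lemma germ0_slope0 n (f : thompson R n) : germ0 f (slope0 f).
Proof.
apply: xgetPex; have [k0 /(_ k0 (leqnn _) 0%N)] := pl_fine (thompson_pl f).
rewrite mul1n expn_gt0 => /(_ isT)[z hz]; exists z, (2 ^- k0).
  exact: exp2V_gt0.
by move=> u /hz; rewrite !mul0r !add0r (pl0 (thompson_pl f)) add0r.
Qed.

Lemma germ1_slope1 n (f : thompson R n) : germ1 f (slope1 f).
Proof.
apply: xgetPex; have [k0 /(_ k0 (leqnn _) (2 ^ k0).-1)] := pl_fine (thompson_pl f).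
rewrite mul1n prednK ?expn_gt0// leqnn => /(_ isT)[z].
set c := _ / _; have ck : c + 2 ^- k0 = 1.
  have -> : c + 2 ^- k0 = ((2 ^ k0).-1%:R + 1) / 2 ^+ k0 by rewrite mulrDl mul1r.
  by rewrite natr1 prednK ?expn_gt0// natrX exp2K.
move=> hz; exists z, (2 ^- k0); first exact: exp2V_gt0.
move=> u hu; have -> : 1 - u = c + (2 ^- k0 - u) by lra.
have := hz (2 ^- k0); rewrite ck lexx ltW ?exp2V_gt0// => ->//.
by rewrite hz; [ring|move: hu; lra].
Qed.

Lemma thompson_0 n (f : thompson R n) : f 0 = 0.
Proof. exact: pl0 (thompson_pl f). Qed.

Lemma thompson_lt n (f : thompson R n) x y :
  0 <= x -> x < y -> y <= 1 -> f x < f y.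
Proof. exact: (pl_lt (thompson_pl f)). Qed.

Lemma pl_end a b f : dyadic_pl a b f -> f a%:R = b%:R.
Proof.
move=> hf; have [|x /andP[x0 xa] fx] := pl_surj hf (y := b%:R).
  by rewrite lexx ler0n.
move: xa; rewrite le_eqVlt => /orP[/eqP <-//|xa].
have := pl_lt hf x0 xa (lexx _); rewrite fx.
by have /andP[_] := pl_range hf (x := a%:R) (ltac:(by rewrite lexx ler0n)); lra.
Qed.

Lemma thompson_1 n (f : thompson R n) : f 1 = n%:R.
Proof. exact: pl_end (thompson_pl f). Qed.

Lemma thompson_dim_gt0 n (f : thompson R n) : (0 < n)%N.
Proof.
rewrite -(ltr_nat R) -(thompson_1 f) -[X in X < _](thompson_0 f).
exact: thompson_lt.
Qed.

Lemma thompson_range n (f : thompson R n) x : 0 <= x <= 1 -> 0 <= f x <= n%:R.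
Proof. by move=> hx; apply: (pl_range (thompson_pl f)); rewrite ?mulr1n. Qed.

Lemma germ0_comp n (f : thompson R n) (g : thompson R 1) :
  germ0 (f \o g) (slope0 f + slope0 g).
Proof.
have [e e0 he] := germ0_slope0 f; have [d d0 hd] := germ0_slope0 g.
exists (Num.min d (2 ^ (- slope0 g) * e)).
  by rewrite lt_min d0 mulr_gt0// exp2z_gt0.
move=> u /andP[u0]; rewrite le_min => /andP[ud ue] /=.
rewrite hd ?u0// he ?exp2zD ?mulrA// mulr_ge0 ?(ltW (exp2z_gt0 _))//=.
move: ue; rewrite -(ler_pM2l (exp2z_gt0 (slope0 g))) mulrA exp2zK; lra.
Qed.

Lemma germ1_comp n (f : thompson R n) (g : thompson R 1) :
  germ1 (f \o g) (slope1 f + slope1 g).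
Proof.
have [e e0 he] := germ1_slope1 f; have [d d0 hd] := germ1_slope1 g.
exists (Num.min d (2 ^ (- slope1 g) * e)).
  by rewrite lt_min d0 mulr_gt0// exp2z_gt0.
move=> u /andP[u0]; rewrite le_min => /andP[ud ue] /=.
rewrite hd ?u0// (thompson_1 g) he ?exp2zD ?mulrA//.
rewrite mulr_ge0 ?(ltW (exp2z_gt0 _))//=.
move: ue; rewrite -(ler_pM2l (exp2z_gt0 (slope1 g))) mulrA exp2zK; lra.
Qed.

Lemma germ0_stretch n (f : thompson R n) (J : {set 'I_n}) (j : 'I_n) :
  j = 0%N :> nat -> germ0 (stretch J \o f) (slope0 f + (j \in J)%:Z).
Proof.
move=> j0; have [e e0 he] := germ0_slope0 f.
exists (Num.min e (2 ^ (- slope0 f))); first by rewrite lt_min e0 exp2z_gt0.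
move=> u /andP[u0]; rewrite le_min => /andP[ue uf] /=.
have sp := exp2z_gt0 (slope0 f).
rewrite he ?u0// (@stretch_slope _ _ J j) j0.
  by rewrite stretch0 add0r subr0 exp2zD mulrA; case: (j \in J);
     rewrite ?expr1z ?expr0z ?mulr1 ?mul1r// [_ * 2]mulrC.
rewrite mulr_ge0 ?(ltW sp)//=.
by move: uf; rewrite -(ler_pM2l sp) exp2zK.
Qed.

Lemma germ1_stretch n (f : thompson R n) (J : {set 'I_n}) (j : 'I_n) :
  j.+1 = n -> germ1 (stretch J \o f) (slope1 f + (j \in J)%:Z).
Proof.
move=> j1; have [e e0 he] := germ1_slope1 f.
exists (Num.min e (2 ^ (- slope1 f))); first by rewrite lt_min e0 exp2z_gt0.
move=> u /andP[u0]; rewrite le_min => /andP[ue uf] /=.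
have sp := exp2z_gt0 (slope1 f).
have f1 : f 1 = j%:R + 1 by rewrite thompson_1 natr1 j1.
have uf1 : 2 ^ slope1 f * u <= 1 by rewrite -[leRHS](exp2zK (slope1 f)) ler_pM2l.
have uf0 : 0 <= 2 ^ slope1 f * u by rewrite mulr_ge0 ?(ltW sp).
have S y : j%:R <= y <= j%:R + 1 ->
    stretch J y = stretch J j%:R + (if j \in J then 2 else 1) * (y - j%:R).
  by rewrite natr1; apply: stretch_slope.
rewrite he ?u0// f1 (S (j%:R + 1)); last by lra.
rewrite (S (j%:R + 1 - _)); last by lra.
by rewrite exp2zD; case: (j \in J); rewrite ?expr1z ?expr0z; ring.
Qed.

Lemma right_derivative_germ f z : germ0 f z -> right_derivative f 0 = 2 ^ z.
Proof.
move=> [e e0 he]; apply: cvg_lim => //; apply: cvg_near_cst.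
have f0 : f 0 = 0 by rewrite he ?mulr0// lexx ltW.
near=> x; have x0 : 0 < x by near: x; exact: nbhs_right_gt.
have xe : x <= e by near: x; exact: nbhs_right_ltW.
by rewrite f0 !subr0 he ?(ltW x0)// mulfK// gt_eqF.
Unshelve. all: by end_near. Qed.

Lemma left_derivative_germ f z : germ1 f z -> left_derivative f 1 = 2 ^ z.
Proof.
move=> [e e0 he]; apply: cvg_lim => //; apply: cvg_near_cst.
near=> x; have x0 : x < 1 by near: x; exact: nbhs_left_lt.
have xe : 1 - e <= x by near: x; apply: nbhs_left_ge; lra.
have -> : f x = f 1 - 2 ^ z * (1 - x) by rewrite -he; [congr f|]; lra.
have x1 : x - 1 != 0 by rewrite subr_eq0 lt_eqF.
by field.
Unshelve. all: by end_near. Qed.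

Lemma log2_exp z : log2 (2 ^ z : R) = z%:~R.
Proof.
have l2 : ln (2 : R) != 0 by rewrite gt_eqF// ln_gt0// ltr1n.
rewrite /log2; case: z => m.
  by rewrite -exprnP lnXn// -[ln 2 *+ m]mulr_natl mulfK.
by rewrite NegzE -exprnN lnV ?posrE ?exp2_gt0// lnXn// -[ln 2 *+ _]mulr_natl mulNr mulfK// rmorphN.
Qed.

Lemma pl_inverse a b f : dyadic_pl a b f ->
  exists h, [/\ dyadic_pl b a h, forall x, 0 <= x <= a%:R -> h (f x) = x &
                forall y, 0 <= y <= b%:R -> f (h y) = y].
Proof.
move=> hf; have [cf bf [S dS hS]] := hf.
have /choice[h hP] : forall y : R, exists x : R,
    0 <= y <= b%:R -> 0 <= x <= a%:R /\ f x = y.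
  move=> y; case: (boolP (0 <= y <= b%:R)) => [hy|_]; last by exists 0.
  by have [x xa fx] := pl_surj hf hy; exists x.
have fle (x y : R) : 0 <= x <= a%:R -> 0 <= y <= a%:R -> (f x <= f y) = (x <= y).
  move=> /andP[x0 xa] /andP[y0 ya]; case: (leP x y) => [|yx].
    by rewrite le_eqVlt => /orP[/eqP->|xy]; rewrite ?lexx// ltW// (pl_lt hf).
  by apply/negbTE; rewrite -ltNge (pl_lt hf).
have finj (x y : R) : 0 <= x <= a%:R -> 0 <= y <= a%:R -> f x = f y -> x = y.
  by move=> hx hy e; apply/eqP; rewrite eq_le -(fle x y)// -(fle y x)// e lexx.
have hf1 (x : R) : 0 <= x <= a%:R -> h (f x) = x.
  by move=> hx; have [? ?] := hP _ (pl_range hf hx); exact: finj.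
have hle (x y : R) : 0 <= x <= b%:R -> 0 <= y <= b%:R -> (h x <= h y) = (x <= y).
  by move=> /hP[hx ex] /hP[hy ey]; rewrite -fle// ex ey.
have h0 : h 0 = 0 by rewrite -{1}(pl0 hf) hf1// lexx ler0n.
have hb : h b%:R = a%:R by rewrite -(pl_end hf) hf1// lexx ler0n.
exists h; split=> //; last by move=> y /hP[].
split.
- apply: segment_inc_surj_continuous.
    by move=> x y; rewrite !in_itv /=; apply: hle.
  rewrite h0 hb => x /=; rewrite in_itv /= => hx.
  by exists (f x); [rewrite /= in_itv /=; apply: pl_range hf _ hx|exact: hf1].
- split.
  + by move=> y; rewrite /= !in_itv /= => /hP[].
  + move=> x y; rewrite !inE /= !in_itv /= => /hP[_ e1] /hP[_ e2] e.
    by rewrite -e1 -e2 e.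
  + move=> x; rewrite /= in_itv /= => hx.
    by exists (f x); [rewrite /= in_itv /=; apply: pl_range hf _ hx|exact: hf1].
exists [seq f s | s <- S & 0 <= s <= a%:R].
  move=> t /mapP[s]; rewrite mem_filter => /andP[sa sS] ->.
  by apply/(pl_dyadic hf sa); apply: dS.
move=> x y x0 xy yb free.
have xb : 0 <= x <= b%:R by rewrite x0 (le_trans xy).
have yb' : 0 <= y <= b%:R by rewrite yb (le_trans x0).
have [hx ex] := hP _ xb; have [hy ey] := hP _ yb'.
have [||||z hz] := hS (h x) (h y).
- by case/andP: hx.
- by rewrite hle.
- by case/andP: hy.
- move=> s sS; apply/negP => /andP[xs sy].
  have sa : 0 <= s <= a%:R by move: hx hy; lra.
  have fsS : f s \in [seq f s | s <- S & 0 <= s <= a%:R].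
    by apply: map_f; rewrite mem_filter sa.
  move/negP: (free _ fsS); apply.
  by rewrite -{1}ex -ey !ltNge !fle// -!ltNge xs.
exists (- z) => u /andP[xu uy].
have ub : 0 <= u <= b%:R by move: xb yb'; lra.
have [hu eu] := hP _ ub.
have : f (h u) = f (h x) + 2 ^ z * (h u - h x) by apply: hz; rewrite !hle// xu.
rewrite ex eu => e.
have -> : u - x = 2 ^ z * (h u - h x) by lra.
by rewrite mulrA -exp2zD addNr expr0z; lra.
Qed.

Lemma thompson_inverse (g : thompson R 1) : exists h : thompson R 1,
  (forall u, 0 <= u <= 1 -> h (g u) = u) /\ (forall u, 0 <= u <= 1 -> g (h u) = u).
Proof.
have [h [hpl hg gh]] := pl_inverse (thompson_pl g).
(* Elements of type [thompson] are constant on both sides of [[0, 1]], hence the clamp. *)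
pose h' u := h (Num.max 0 (Num.min 1 u)).
have h'E u : 0 <= u <= 1 -> h' u = h u.
  by move=> hu; rewrite /h'; congr h; case: clampP => ?; lra.
have hpl' : dyadic_pl 1 1 h'.
  have [c b [S dS hS]] := hpl; split.
  - by apply: subspace_eq_continuous c => x; rewrite inE /= in_itv /= => /h'E.
  - by apply: eq_set_bijRL b => x; rewrite inE /= in_itv /= => /h'E.
  - exists S => // x y x0 xy y1 free; have [z hz] := hS _ _ x0 xy y1 free.
    by exists z => u /[dup] hu /hz; rewrite !h'E//; move: hu y1; lra.
have h'0 u : u <= 0 -> h' u = h' 0.
  by move=> u0; congr h; do 2!case: clampP => ?; lra.
have h'1 u : 1 <= u -> h' u = h' 1.
  by move=> u0; congr h; do 2!case: clampP => ?; lra.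
exists (Thompson hpl' h'0 h'1) => /=; split=> u hu.
  by rewrite h'E ?hg//; apply: (thompson_range g).
by rewrite h'E ?gh.
Qed.

Lemma thompson_cancel n (f : thompson R n) (g h : thompson R 1) :
  (forall u, 0 <= u <= 1 -> g (h u) = u) ->
  thompson_comp (thompson_comp f g) h = f.
Proof.
move=> gh; apply: thompson_eq; apply: funext => u /=.
have [u0|u0] := leP u 0.
  by rewrite (thompson_le0 h u0) gh ?lexx ?ler01//= (thompson_le0 f u0).
have [u1|u1] := leP 1 u.
  by rewrite (thompson_ge1 h u1) gh ?lexx ?ler01//= (thompson_ge1 f u1).
by rewrite gh// !ltW.
Qed.

End PiecewiseLinear.

(** * Gluing of cubes *)

Section Gluing.
Variable R : realType.
Implicit Types (n m : nat) (p q : cube_point R).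

Lemma to_X_glue p q : Defs.glue p q -> to_X p = to_X q.
Proof. by move=> h; apply/eqmodP/asboolP; apply: rst_step. Qed.

Lemma to_X_ind (T : Type) (F : cube_point R -> T) :
  (forall p q, Defs.glue p q -> F p = F q) ->
  forall p q, to_X p = to_X q -> F p = F q.
Proof.
move=> hF p q /eqmodP/asboolP; elim=> [{}p {}q /hF|||{}p {}q r _ -> _ ->] //.
Qed.

Lemma unit_cube_eq n (t u : unit_cube R n) :
  (forall i, t 0 i = u 0 i) -> t = u.
Proof.
case: t u => [t t1] [u u1] /= tu.
have e : t = u by apply/rowP.
by case: _ / e u1 tu => u1 _; congr UnitCube; apply: Prop_irrelevance.
Qed.

Lemma to_X_eq n m (f : thompson R n) (h : thompson R m)
    (t : unit_cube R n) (u : unit_cube R m) :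
  n = m -> f = h :> (R -> R) ->
  (forall (i : 'I_n) (k : 'I_m), i = k :> nat -> t 0 i = u 0 k) ->
  to_X (CubePoint f t) = to_X (CubePoint h u).
Proof.
move=> e; case: _ / e h u => h u /thompson_eq <- tu.
by congr (to_X (CubePoint _ _)); apply: unit_cube_eq => i; apply: tu.
Qed.

Lemma stretch_set0 n y : stretch (finset.set0 : {set 'I_n}) y = y :> R.
Proof. by rewrite /stretch big_set0 addr0. Qed.

(** Gluing along faces of dimension 0: the vertex [chi J] of [C(f)] is the origin of [C(f[J])]. *)
Lemma glue_vertex n m (f : thompson R n) (h : thompson R m)
    (J : {set 'I_n}) (t : unit_cube R n) (u : unit_cube R m) :
  (forall y, h y = stretch J (f y)) -> (forall i, t 0 i = (i \in J)%:R) ->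
  (forall i, u 0 i = 0) -> to_X (CubePoint f t) = to_X (CubePoint h u).
Proof.
move=> hf tJ u0; apply: to_X_glue.
have faceJ k (I : {set 'I_k}) (v : 'rV[R]_k) : face I I v <-> v = chi R I.
  split=> [hv|->]; last first.
    by move=> i; rewrite mxE; case: (i \in I); rewrite ?lexx ?ler01.
  apply/rowP => i; rewrite mxE; have [_ h1 h2] := hv i.
  by case: (boolP (i \in I)) => [/h1|/h2].
have tE : cube_coord t = chi R J by apply/rowP => i; rewrite mxE tJ.
have chi0 : chi R (finset.set0 : {set 'I_m}) = 0 by apply/rowP => i; rewrite !mxE inE.
have uE : cube_coord u = 0 by apply/rowP => i; rewrite mxE u0.
exists J, J, finset.set0, finset.set0, (fun=> 0) => /=; split=> //; last first.
  by apply/faceJ.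
split=> //.
- by exists 0, 0 => v; rewrite mulmx0 addr0.
- split.
  + by move=> v _; apply/faceJ; rewrite chi0.
  + by move=> v w; rewrite !inE => /faceJ -> /faceJ ->.
  + by move=> v /faceJ ->; exists (chi R J); [apply/faceJ|].
- move=> I JI IJ; exists finset.set0; rewrite !finset.sub0set chi0; split=> //.
  have -> : I = J by apply/eqP; rewrite finset.eqEsubset IJ.
  by apply: funext => y /=; rewrite stretch_set0 hf.
Qed.

(** With [j1 = lift ord0 j], the two halves of interval [j] get the numbers [lift j1 j] and [j1],
    and any other interval [i] gets [lift j1 i]. Hence [f[I]] is reached from [f[{j}]] by splitting
    the renumbered rest of [I]. *)
Lemma stretch_comp_split n (I : {set 'I_n}) (j : 'I_n) y : j \in I ->
  stretch [set lift (lift ord0 j) i | i in I :\ j] (stretch [set j] y) =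
  stretch I y :> R.
Proof.
move=> jI; rewrite [in RHS]/stretch (big_setD1 j)//= addrA.
rewrite {1}/stretch big_imset/=; last by move=> i k _ _; apply: lift_inj.
rewrite {1}/stretch big_set1; congr (_ + _); apply: eq_bigr => i.
rewrite !inE => /andP[ij _]; rewrite /stretch big_set1 /bump /=.
have [ji|] := ltnP j i.
  have : j%:R + 1 <= i%:R :> R by rewrite natr1 ler_nat.
  by rewrite -natr1 => h; case: (clampP (y - j%:R)) => ?; do !case: clampP => ?; lra.
rewrite leq_eqVlt (negbTE (_ : (i != j :> nat)))//= add0n => ltij.
have : i%:R + 1 <= j%:R :> R by rewrite natr1 ler_nat.
by move=> h; case: (clampP (y - j%:R)) => ?; do !case: clampP => ?; lra.
Qed.

(** The face of [C(f)] where coordinate [j] is 1 is the face of [C(f[{j}])] where both halves of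
    interval [j] have coordinate 0. The gluing map drops coordinate [j] and renumbers the others. *)
Lemma glue_split n (f : thompson R n) (h : thompson R n.+1) (j : 'I_n)
    (t : unit_cube R n) (u : unit_cube R n.+1) :
  (forall y, h y = stretch [set j] (f y)) -> t 0 j = 1 ->
  (forall i, i != j -> u 0 (lift (lift ord0 j) i) = t 0 i) ->
  u 0 (lift ord0 j) = 0 -> u 0 (lift (lift ord0 j) j) = 0 ->
  to_X (CubePoint f t) = to_X (CubePoint h u).
Proof.
move=> hf tj ut u1 u2; apply: to_X_glue; set j1 := lift ord0 j in ut u1 u2 *.
pose A : 'M[R]_(n, n.+1) := \matrix_(i, k) ((i != j) && (k == lift j1 i))%:R.
pose phi (v : 'rV[R]_n) := v *m A + 0.
have phiE v k : phi v 0 k = \sum_(i | (i != j) && (k == lift j1 i)) v 0 i.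
  rewrite /phi addr0 mxE [RHS]big_mkcond; apply: eq_bigr => i _; rewrite mxE.
  by case: ifP => _; rewrite ?mulr1 ?mulr0.
have phi_lift v i : i != j -> phi v 0 (lift j1 i) = v 0 i.
  move=> ij; rewrite phiE (big_pred1 i)// => k /=.
  by rewrite (inj_eq (@lift_inj _ j1)) [i == k]eq_sym; case: (k =P i) => [->|_]; rewrite ?ij ?andbF.
have phi_j1 v : phi v 0 j1 = 0.
  by rewrite phiE big1// => i /andP[_ /eqP e]; have := neq_lift j1 i; rewrite -e eqxx.
have phi_j v : phi v 0 (lift j1 j) = 0.
  by rewrite phiE big1// => i /andP[/negP ij /eqP/lift_inj e]; case: ij; rewrite e.
have cases (P : 'I_n.+1 -> Prop) : P j1 -> P (lift j1 j) ->
    (forall i, i != j -> P (lift j1 i)) -> forall k, P k.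
  move=> P1 P2 P3 k; case: (unliftP j1 k) => [i ->|->//].
  by have [->//|/P3] := eqVneq i j.
pose K' : {set 'I_n.+1} := [set lift j1 i | i in [set: 'I_n] :\ j].
have liftK' i (I : {set 'I_n}) : (lift j1 i \in [set lift j1 i | i in I :\ j]) = (i != j) && (i \in I).
  by rewrite mem_imset ?inE//; exact: lift_inj.
have j1K' (I : {set 'I_n}) : j1 \in [set lift j1 i | i in I :\ j] = false.
  by apply/negP => /imsetP[i _ e]; have := neq_lift j1 i; rewrite -e eqxx.
have jt : face [set j] [set: 'I_n] t.
  move=> i; rewrite !inE; split=> // [|/eqP -> //].
  exact: cube_coordP.
exists [set j], [set: 'I_n], finset.set0, K', phi => /=; split=> //; last first.
  apply/rowP; apply: cases; rewrite ?phi_j1 ?phi_j// => i ij.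
  by rewrite phi_lift// ut.
split; rewrite ?finset.subsetT ?finset.sub0set//.
- by exists A, 0.
- split.
  + move=> v hv; apply: cases; rewrite ?phi_j1 ?phi_j ?inE ?lexx ?ler01; try by split.
    move=> i ij; rewrite phi_lift// inE liftK' ij inE; split=> //.
    by have [] := hv i.
  + move=> v w; rewrite !inE => hv hw e; apply/rowP => i.
    have [->|ij] := eqVneq i j.
      have [_ hvj _] := hv j; have [_ hwj _] := hw j.
      by rewrite hvj ?hwj// finset.inE.
    by rewrite -!(phi_lift _ i) ?e.
  + move=> v hv; pose w : 'rV[R]_n := \row_i (if i == j then 1 else v 0 (lift j1 i)).
    exists w.
      move=> i; rewrite !inE !mxE; split=> //; last by move=> ->.
      by case: eqP => _; [rewrite lexx ler01|have [] := hv (lift j1 i)].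
    apply/rowP; apply: cases.
    * by rewrite phi_j1; have [_ _ ->] := hv j1; rewrite // j1K'.
    * by rewrite phi_j; have [_ _ ->] := hv (lift j1 j); rewrite // liftK' eqxx.
    * by move=> i ij; rewrite phi_lift// mxE (negbTE ij).
- move=> I; rewrite finset.sub1set => jI _.
  exists [set lift j1 i | i in I :\ j]; rewrite finset.sub0set; split=> //.
  + by apply/imsetS/finset.setSD/finset.subsetT.
  + apply/rowP; apply: cases; rewrite ?phi_j1 ?phi_j ?mxE ?j1K' ?liftK' ?eqxx//.
    by move=> i ij; rewrite phi_lift// !mxE liftK' ij.
  + by apply: funext => y /=; rewrite hf stretch_comp_split.
Qed.

End Gluing.

(** * Points of the complex given by subdivisions *)

Section Chains.
Variable R : realType.
Implicit Types (x y z : X R) (l : R).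

Lemma cube_dist_ge0 n (t u : 'rV[R]_n) : 0 <= cube_dist t u.
Proof. exact: sqrtr_ge0. Qed.

Lemma cube_distC n (t u : 'rV[R]_n) : cube_dist t u = cube_dist u t.
Proof.
by congr Num.sqrt; apply: eq_bigr => i _; rewrite -sqrrN opprB.
Qed.

Lemma chain_ge0 x y l : chain x y l -> 0 <= l.
Proof. by elim=> // *; rewrite addr_ge0 ?cube_dist_ge0. Qed.

Lemma chain_trans x y z l l' : chain x y l -> chain y z l' -> chain x z (l + l').
Proof.
move=> h; elim=> [|w k n f t u _ hw yE]; first by rewrite addr0.
by rewrite addrA; apply: chain_step hw yE.
Qed.

Lemma chain_segment n (f : thompson R n) (t u : unit_cube R n) :
  chain (to_X (CubePoint f t)) (to_X (CubePoint f u)) (cube_dist t u).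
Proof. by rewrite -[cube_dist t u]add0r; apply: chain_step (chain_refl _) erefl. Qed.

Lemma chain_sym x y l : chain x y l -> chain y x l.
Proof.
elim=> [|w k n f t u _ hw wE]; first exact: chain_refl.
rewrite addrC cube_distC; apply: chain_trans hw.
by rewrite wE; apply: chain_segment.
Qed.

Lemma distX_le x y l : chain x y l -> distX x y <= l.
Proof.
by move=> h; apply: ge_inf => //; exists 0 => k /chain_ge0.
Qed.

Lemma distX_ge x y c : (exists l, chain x y l) ->
  (forall l, chain x y l -> c <= l) -> c <= distX x y.
Proof. by move=> [l hl] h; apply: lb_le_inf; [exists l|]. Qed.

Lemma distXC x y : distX x y = distX y x.
Proof.
by congr inf; apply/seteqP; split=> l /= /chain_sym.
Qed.

End Chains.

(** * Lists of depths and coordinates, and moves between them *)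

Section ListPoints.
Variable R : realType.
Implicit Types (A B L M X Y : seq (nat * R)) (ds : seq nat) (c e : R) (a b : nat).

Definition depths L : seq nat := map fst L.
Definition in01 (s : R) : bool := 0 <= s <= 1.
Definition cval L : bool := all (fun q => in01 q.2) L.
Definition valid L : Prop := tot R (depths L) = 1 /\ cval L.

(* The point with coordinates [q.2] in the cube of the vertex given by the
   subdivision of [0, 1] into intervals of lengths [2^-q.1], [q] in [L]. *)
Definition is_pt L (x : Defs.X R) : Prop :=
  exists n (f : thompson R n) (t : unit_cube R n),
    [/\ n = size L, f = plf 0 (depths L) :> (R -> R),
        forall i : 'I_n, t 0 i = (nth (0%N, 0) L i).2
      & x = to_X (CubePoint f t)].

Lemma is_pt_uniq L x y : is_pt L x -> is_pt L y -> x = y.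
Proof.
move=> [n [f [t [n1 f1 t1 ->]]]] [m [h [u [m1 h1 u1 ->]]]].
apply: to_X_eq; rewrite ?n1 ?f1// => i k ik; by rewrite t1 u1 ik.
Qed.

Lemma valid_pt L : valid L -> exists x, is_pt L x.
Proof.
move=> [L1 /allP LV].
have tP i : (0 : R) <= (\row_(i < size (depths L)) (nth (0%N, 0) L i).2) 0 i <= 1.
  by rewrite mxE; apply: LV; apply: mem_nth; rewrite -(size_map fst).
exists (to_X (CubePoint (vert L1) (UnitCube tP))).
exists (size (depths L)), (vert L1), (UnitCube tP); split=> //.
  exact: size_map.
by move=> i; rewrite mxE.
Qed.

(** Rewritings that keep the point of [X]; the generating one is the gluing of [glue_split]. *)
Inductive eqv : seq (nat * R) -> seq (nat * R) -> Prop :=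
| eqv_refl L : eqv L L
| eqv_sym L M : eqv L M -> eqv M L
| eqv_trans L M N : eqv L M -> eqv M N -> eqv L N
| eqv_split A B d : eqv (A ++ (d, 1) :: B) (A ++ (d.+1, 0) :: (d.+1, 0) :: B).

Lemma cval_cat A B : cval (A ++ B) = cval A && cval B.
Proof. exact: all_cat. Qed.

Lemma depths_cat A B : depths (A ++ B) = depths A ++ depths B.
Proof. exact: map_cat. Qed.

Lemma eqv_cval L M : eqv L M -> cval L = cval M.
Proof.
elim=> // [{}L {}M P _ -> _ ->|A B d] //.
by rewrite !cval_cat /= /in01 /= lexx ler01 lexx.
Qed.

Lemma eqv_tot L M : eqv L M -> tot R (depths L) = tot R (depths M).
Proof.
elim=> // [{}L {}M P _ -> _ ->|A B d] //.
by rewrite !depths_cat !tot_cat /= !tot_cons (exp2VS R d) !addrA.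
Qed.

Lemma eqv_valid L M : eqv L M -> valid L <-> valid M.
Proof. by move=> h; rewrite /valid (eqv_cval h) (eqv_tot h). Qed.

Lemma split_pt A B d x : valid (A ++ (d, 1) :: B) ->
  is_pt (A ++ (d, 1) :: B) x -> is_pt (A ++ (d.+1, 0) :: (d.+1, 0) :: B) x.
Proof.
move=> v [n [f [t [nE fE tE ->]]]].
have [y hy] := valid_pt (iffLR (eqv_valid (eqv_split A B d)) v).
suff -> : to_X (CubePoint f t) = y by [].
have [m [h [u [mE hE uE ->]]]] := hy.
have mn : m = n.+1 by rewrite nE mE !size_cat /= !addnS.
clear mE; subst m; subst n.
have jA : (size A < size (A ++ (d, 1%R) :: B))%N by rewrite size_cat /= addnS ltnS leq_addr.
have nthA k : nth (0%N, 0) (A ++ (d.+1, 0) :: (d.+1, 0) :: B) (bump (size A).+1 k) =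
   if k == size A then (d.+1, 0) else nth (0%N, 0) (A ++ (d, 1) :: B) k :> nat * R.
  rewrite !nth_cat /bump; case: (ltngtP k (size A)) => [kA|kA|->].
  - by rewrite add0n kA.
  - rewrite add1n ltnNge (leqW (ltnW kA)) /= subSn ?(ltnW kA)//.
    by case: (k - size A)%N (subn_gt0 (size A) k) => //; rewrite kA.
  - by rewrite add0n ltnn subnn.
apply: (@glue_split _ _ f h (Ordinal jA)).
- move=> w; rewrite fE hE !depths_cat /=.
  have jA' : (size (depths A) < size (depths A ++ d :: depths B))%N.
    by rewrite size_cat /= addnS ltnS leq_addr.
  rewrite -(@stretch_plf _ _ _ _ (Ordinal jA'))//= /stretch !big_set1 /=.
  by rewrite /depths size_map.
- by rewrite tE /= nth_cat ltnn subnn.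
- move=> i ij; rewrite uE tE /= nthA ifN//.
- by rewrite uE /= /bump /= add1n nth_cat ltnNge leqnSn /= subSnn.
- by rewrite uE /= nthA eqxx.
Qed.

Lemma eqv_pt L M x : eqv L M -> valid L -> is_pt L x -> is_pt M x.
Proof.
move=> h; suff : valid L -> forall x, is_pt L x <-> is_pt M x.
  by move=> h1 /h1/(_ x)[].
elim: h => // [{}L {}M /eqv_valid h IH /h/IH h' y|{}L {}M P h IH _ IH' v y|A B d v y].
- by split=> /h'.
- by rewrite IH// IH'//; apply/(eqv_valid h).
(* For the converse, the point of the unsplit list is also a point of the split list, and a list
   determines its point. *)
- split=> [|hy]; first exact: split_pt.
  have [z hz] := valid_pt v; suff -> : y = z by [].
  exact: is_pt_uniq hy (split_pt v hz).
Qed.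

Lemma eqv_ctx A B L M : eqv L M -> eqv (A ++ L ++ B) (A ++ M ++ B).
Proof.
elim=> [?|{}L {}M _ /eqv_sym //|{}L {}M P _ h _ /(eqv_trans h)//|A' B' d].
  exact: eqv_refl.
by rewrite -!(catA A') !cat_cons !(catA A A'); apply: eqv_split.
Qed.

Lemma eqv_cat L L' M M' : eqv L L' -> eqv M M' -> eqv (L ++ M) (L' ++ M').
Proof.
move=> /(eqv_ctx [::] M) h1 /(eqv_ctx L' [::]) h2.
by move: h1 h2; rewrite !cats0; apply: eqv_trans.
Qed.

Definition deepen a L : seq (nat * R) := [seq ((a + q.1)%N, q.2) | q <- L].

Lemma deepen_cat a L M : deepen a (L ++ M) = deepen a L ++ deepen a M.
Proof. exact: map_cat. Qed.

Lemma deepen0 L : deepen 0 L = L.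
Proof. by rewrite /deepen -[RHS]map_id; apply: eq_map => -[]. Qed.

Lemma deepenD a b L : deepen (a + b) L = deepen a (deepen b L).
Proof. by rewrite /deepen -map_comp; apply: eq_map => q /=; rewrite addnA. Qed.

Lemma deepen_depths a L : depths (deepen a L) = map (addn a) (depths L).
Proof. by rewrite /depths -!map_comp. Qed.

Lemma deepen_cval a L : cval (deepen a L) = cval L.
Proof. by rewrite /cval all_map. Qed.

Lemma eqv_deepen a L M : eqv L M -> eqv (deepen a L) (deepen a M).
Proof.
elim=> [?|{}L {}M _ /eqv_sym //|{}L {}M P _ h _ /(eqv_trans h)//|A B d].
  exact: eqv_refl.
by rewrite !deepen_cat /= addnS; apply: eqv_split.
Qed.

Implicit Type T : seq (nat * (R * R)).
(** A list [T] encodes a cube, by its depths, together with two points of it; [cost T] is their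
    squared Euclidean distance. *)
Definition lpt T : seq (nat * R) := [seq (q.1, q.2.1) | q <- T].
Definition rpt T : seq (nat * R) := [seq (q.1, q.2.2) | q <- T].
Definition cost T : R := \sum_(q <- T) (q.2.1 - q.2.2) ^+ 2.

(* [L] and [M] are, up to subdivision, points of the same cube at squared
   distance at most [c]. *)
Definition adj c L M : Prop := exists T,
  [/\ cval L, cval M, eqv L (lpt T), eqv (rpt T) M & cost T <= c].

Lemma cost_cat T T' : cost (T ++ T') = cost T + cost T'.
Proof. by rewrite /cost big_cat. Qed.

Lemma adj_cat c L M c' L' M' : adj c L M -> adj c' L' M' ->
  adj (c + c') (L ++ L') (M ++ M').
Proof.
move=> [T [? ? h1 h2 h3]] [T' [? ? h1' h2' h3']]; exists (T ++ T').
rewrite !cval_cat cost_cat /lpt /rpt !map_cat; split.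
- exact/andP.
- exact/andP.
- exact: eqv_cat.
- exact: eqv_cat.
- exact: lerD.
Qed.

Lemma adj_refl L : cval L -> adj 0 L L.
Proof.
move=> hL; exists [seq (q.1, (q.2, q.2)) | q <- L].
have id (F : nat * R -> nat * R) : F =1 id -> map F L = L.
  by move=> h; rewrite -[RHS]map_id; apply: eq_map.
split=> //; rewrite /lpt /rpt -?map_comp ?id; try by [exact: eqv_refl|case].
by rewrite /cost big_map big1// => q _; rewrite subrr expr0n.
Qed.

Lemma adj_eqv c L M M' : eqv M M' -> adj c L M -> adj c L M'.
Proof.
move=> h [T [? ? h1 h2 ?]]; exists T; split=> //; last exact: eqv_trans h2 h.
by rewrite -(eqv_cval h).
Qed.

Lemma adj_sym c L M : adj c L M -> adj c M L.
Proof.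
move=> [T [? ? h1 h2 h3]]; exists [seq (q.1, (q.2.2, q.2.1)) | q <- T].
split=> //; rewrite /lpt /rpt -?map_comp.
- exact: eqv_sym.
- exact: eqv_sym.
- by rewrite /cost big_map (eq_bigr _ (fun q _ => esym (sqrrN _))); under eq_bigr do rewrite opprB.
Qed.

Lemma adj_deepen a c L M : adj c L M -> adj c (deepen a L) (deepen a M).
Proof.
move=> [T [? ? h1 h2 h3]]; exists [seq ((a + q.1)%N, q.2) | q <- T].
split; rewrite ?deepen_cval//.
- by move/(eqv_deepen a): h1; rewrite /lpt /deepen -!map_comp.
- by move/(eqv_deepen a): h2; rewrite /rpt /deepen -!map_comp.
- by rewrite /cost big_map.
Qed.

Fixpoint steps (N : nat) e L M : Prop :=
  if N is N'.+1 then exists2 P, adj e L P & steps N' e P M else L = M.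

(** Two paths with the same number of moves on disjoint parts of the interval run simultaneously in
    orthogonal directions, so the squared lengths add move by move. *)
Lemma steps_cat N e L M e' L' M' : steps N e L M -> steps N e' L' M' ->
  steps N (e + e') (L ++ L') (M ++ M').
Proof.
elim: N L L' => [|N IH] L L' /=; first by move=> -> ->.
by move=> [P h1 h2] [P' h1' h2']; exists (P ++ P'); [exact: adj_cat|exact: IH].
Qed.

Lemma steps_trans N N' e L P M : steps N e L P -> steps N' e P M ->
  steps (N + N') e L M.
Proof.
elim: N L => [|N IH] L /=; first by move=> ->.
by move=> [Q h1 h2] h3; exists Q => //; apply: IH.
Qed.

Lemma steps_sym N e L M : steps N e L M -> steps N e M L.
Proof.
elim: N L => [|N IH] L; first by move=> /= ->.
move=> [P /adj_sym h1 /IH h2]; rewrite -addn1.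
by apply: steps_trans h2 _; exists L.
Qed.

Lemma steps_refl N L : cval L -> steps N 0 L L.
Proof. by move=> hL; elim: N => //= N IH; exists L => //; apply: adj_refl. Qed.

Lemma steps_ctx N e A B L M : cval A -> cval B -> steps N e L M ->
  steps N e (A ++ L ++ B) (A ++ M ++ B).
Proof.
move=> hA hB h; rewrite -[e]addr0 -[e + 0]add0r.
by apply: steps_cat; [exact: steps_refl|apply: steps_cat => //; exact: steps_refl].
Qed.

Lemma adj_steps c L M N : (0 < N)%N -> adj c L M -> steps N (c / N%:R ^+ 2) L M.
Proof.
case: N => // N _ [T [cL cM h1 h2 h3]]; have n0 : (0 : R) < N.+1%:R by rewrite ltr0n.
have cl : cval (lpt T) by rewrite -(eqv_cval h1).
have cr : cval (rpt T) by rewrite (eqv_cval h2).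
(* Equally spaced points of the segment, numbered backwards from [rpt T] at [k = 0] to [lpt T] at
   [k = N.+1]. *)
pose I (k : nat) := [seq (q.1, k%:R / N.+1%:R * q.2.1 + (1 - k%:R / N.+1%:R) * q.2.2) | q <- T].
have cI k : (k <= N.+1)%N -> cval (I k).
  move=> kN; rewrite /cval all_map; apply/allP => q qT /=.
  have := allP cl (q.1, q.2.1) (map_f (fun q => (q.1, q.2.1)) qT).
  have := allP cr (q.1, q.2.2) (map_f (fun q => (q.1, q.2.2)) qT).
  rewrite /in01 /=; set r := k%:R / N.+1%:R.
  have r0 : 0 <= r by rewrite divr_ge0 ?ler0n.
  have r1 : r <= 1 by rewrite ler_pdivrMr// mul1r ler_nat.
  move=> /andP[a0 a1] /andP[b0 b1].
  by apply/andP; split; nra.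
have adjI k : (k < N.+1)%N -> adj (c / N.+1%:R ^+ 2) (I k.+1) (I k).
  move=> kN; exists [seq (q.1, (k.+1%:R / N.+1%:R * q.2.1 + (1 - k.+1%:R / N.+1%:R) * q.2.2,
     k%:R / N.+1%:R * q.2.1 + (1 - k%:R / N.+1%:R) * q.2.2)) | q <- T].
  split; rewrite ?cI ?(ltnW kN)//; rewrite /lpt /rpt -?map_comp; try exact: eqv_refl.
  rewrite /cost big_map ler_pdivlMr ?exprn_gt0// mulr_suml; apply: le_trans h3.
  rewrite le_eqVlt; apply/orP; left; apply/eqP; apply: eq_bigr => q _ /=.
  rewrite -[k.+1%:R]natr1; field; exact: lt0r_neq0.
(* The path must start and end at [L] and [M] themselves; the first and the last move absorb the
   equivalences [h1] and [h2]. *)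
suff P k : (k < N.+1)%N -> steps k.+1 (c / N.+1%:R ^+ 2) (I k.+1) M.
  have : steps N.+1 (c / N.+1%:R ^+ 2) (I N.+1) M by exact: P.
  have e1 : I N.+1 = lpt T.
    by apply: eq_map => q; rewrite divff ?(lt0r_neq0 n0)// mul1r subrr mul0r addr0.
  rewrite e1 => -[Q hQ hQ']; exists Q => //.
  by apply: adj_sym; apply: adj_eqv (eqv_sym h1) (adj_sym hQ).
have e0 : I 0%N = rpt T.
  by apply: eq_map => q; rewrite mul0r mul0r add0r subr0 mul1r.
elim: k => [|k IH] kN; last by exists (I k.+1); [exact: adjI|exact: IH (ltnW kN)].
exists M => //; apply: adj_eqv h2 _; rewrite -e0; exact: adjI.
Qed.

Definition zl ds : seq (nat * R) := [seq (d, 0) | d <- ds].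

Lemma cval_zl ds : cval (zl ds).
Proof. by rewrite /cval all_map; apply/allP => d _ /=; rewrite /in01 lexx ler01. Qed.

Lemma zl_cat ds ds' : zl (ds ++ ds') = zl ds ++ zl ds'.
Proof. exact: map_cat. Qed.

Lemma depths_zl ds : depths (zl ds) = ds.
Proof. by rewrite /depths -map_comp map_id. Qed.

Lemma deepen_zl a ds : deepen a (zl ds) = zl (map (addn a) ds).
Proof. by rewrite /deepen /zl -!map_comp. Qed.

(** A subdivision is an edge of a cube, along which the coordinate of the piece goes from 0 to 1. *)
Lemma adj_unit d : adj 1 (zl [:: d]) (zl [:: d.+1; d.+1]).
Proof.
exists [:: (d, (0, 1))]; split; rewrite ?cval_zl//.
- exact: eqv_refl.
- exact: (eqv_split [::] [::] d).
- by rewrite /cost big_seq1 /= sub0r sqrrN expr1n.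
Qed.

Lemma iota_rcons d a : iota d.+1 a.+1 = iota d.+1 a ++ [:: (d + a).+1].
Proof. by rewrite -[a.+1]addn1 iotaD addSn. Qed.

(** The leftmost piece is halved [a] times, each time in [N] moves of length [1/N]. The resulting
    depths are [d+a, d+a, d+a-1, ..., d+1]. *)
Lemma steps_left_split N d a : (0 < N)%N ->
  steps (a * N) (1 / N%:R ^+ 2) (zl [:: d])
    (zl ((d + a)%N :: rev (iota d.+1 a))).
Proof.
move=> N0; elim: a => [|a IH]; first by rewrite addn0.
rewrite mulSn addnC; apply: steps_trans IH _.
have -> : zl ((d + a.+1)%N :: rev (iota d.+1 a.+1)) =
    [::] ++ zl [:: (d + a).+1; (d + a).+1] ++ zl (rev (iota d.+1 a)).
  by rewrite iota_rcons -zl_cat rev_cat addnS.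
apply: (steps_ctx (A := [::]) (L := zl [:: (d + a)%N])) => //.
  exact: cval_zl.
exact: adj_steps N0 (adj_unit _).
Qed.

Lemma steps_right_split N d a : (0 < N)%N ->
  steps (a * N) (1 / N%:R ^+ 2) (zl [:: d])
    (zl (rcons (iota d.+1 a) (d + a)%N)).
Proof.
move=> N0; elim: a => [|a IH]; first by rewrite addn0.
rewrite mulSn addnC; apply: steps_trans IH _.
have -> : zl (rcons (iota d.+1 a.+1) (d + a.+1)%N) =
    zl (iota d.+1 a) ++ zl [:: (d + a).+1; (d + a).+1] ++ [::].
  by rewrite iota_rcons cats0 -cats1 -catA -zl_cat addnS.
rewrite -cats1 zl_cat -[zl [:: (d + a)%N]]cats0.
apply: steps_ctx; rewrite ?cval_zl//.
exact: adj_steps N0 (adj_unit _).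
Qed.

(** The index bounds the sum of the squares of the lengths of the steps rather than the length: it
    is the squared length of one move that performs all these steps at once in orthogonal
    directions. *)
Inductive cpath : R -> seq (nat * R) -> seq (nat * R) -> Prop :=
| cpath_nil L : cpath 0 L L
| cpath_step c c' L P M : adj c L P -> cpath c' P M -> cpath (c + c') L M.

Lemma cpath_trans c c' L P M : cpath c L P -> cpath c' P M -> cpath (c + c') L M.
Proof.
elim=> [Q|c1 c2 L' P' M' h _ IH /IH]; first by rewrite add0r.
by rewrite -addrA; apply: cpath_step.
Qed.

Lemma cpath_sym c L M : cpath c L M -> cpath c M L.
Proof.
elim=> [Q|c1 c2 L' P' M' /adj_sym h _ IH]; first exact: cpath_nil.
rewrite addrC; apply: cpath_trans IH _; rewrite -[c1]addr0.
by apply: cpath_step h _; apply: cpath_nil.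
Qed.

Lemma adj_ctx c A B L M : cval A -> cval B -> adj c L M ->
  adj c (A ++ L ++ B) (A ++ M ++ B).
Proof.
move=> hA hB h; rewrite -[c]addr0 -[c + 0]add0r.
by apply: adj_cat; [exact: adj_refl|apply: adj_cat => //; exact: adj_refl].
Qed.

Lemma cpath_ctx c A B L M : cval A -> cval B -> cpath c L M ->
  cpath c (A ++ L ++ B) (A ++ M ++ B).
Proof.
move=> hA hB; elim=> [Q|c1 c2 L' P' M' h _]; first exact: cpath_nil.
by apply: cpath_step; apply: adj_ctx.
Qed.

Definition joined ds ds' := forall e, 0 < e ->
  exists2 c, c <= e & cpath c (zl ds) (zl ds').

Lemma joined_refl ds : joined ds ds.
Proof. by move=> e e0; exists 0; [exact: ltW|exact: cpath_nil]. Qed.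

Lemma joined_sym ds ds' : joined ds ds' -> joined ds' ds.
Proof. by move=> h e /h[c ce /cpath_sym]; exists c. Qed.

Lemma joined_trans ds ds' ds'' : joined ds ds' -> joined ds' ds'' -> joined ds ds''.
Proof.
move=> h h' e e0; have e2 : 0 < e / 2 by rewrite divr_gt0.
have [c ce hc] := h _ e2; have [c' ce' hc'] := h' _ e2.
by exists (c + c'); [lra|exact: cpath_trans hc hc'].
Qed.

Lemma joined_cat ds ds' es es' : joined ds ds' -> joined es es' ->
  joined (ds ++ es) (ds' ++ es').
Proof.
move=> h h'; apply: (@joined_trans _ (ds' ++ es)) => e e0.
  have [c ce hc] := h _ e0; exists c => //; rewrite !zl_cat.
  exact: (cpath_ctx (A := [::]) _ (cval_zl _) hc).
have [c ce hc] := h' _ e0; exists c => //; rewrite !zl_cat.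
by have := cpath_ctx (B := [::]) (cval_zl ds') _ hc; rewrite !cats0; apply.
Qed.

Lemma steps_cpath N e L M : steps N e L M -> cpath (N%:R * e) L M.
Proof.
elim: N L => [|N IH] L /=; first by move=> ->; rewrite mul0r; exact: cpath_nil.
move=> [P h /IH h']; rewrite -natr1 mulrDl mul1r addrC.
exact: cpath_step h h'.
Qed.

(** An edge of length 1 cut into [N] equal parts has sum of squares [1/N]. *)
Lemma joined_split d : joined [:: d] [:: d.+1; d.+1].
Proof.
move=> e e0; have N0 : (0 : R) < (Num.truncn e^-1).+1%:R by rewrite ltr0n.
exists ((Num.truncn e^-1).+1%:R * (1 / (Num.truncn e^-1).+1%:R ^+ 2)).
  rewrite expr2 mul1r invfM mulrA divff ?mul1r ?(lt0r_neq0 N0)//.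
  rewrite -[leRHS]invrK lef_pV2 ?posrE ?invr_gt0//.
  by apply/ltW/truncnS_gt.
exact: steps_cpath (adj_steps _ (adj_unit _)).
Qed.

Lemma joined_uniform d k : joined [:: d] (nseq (2 ^ k) (d + k)%N).
Proof.
elim: k d => [|k IH] d; first by rewrite addn0; apply: joined_refl.
apply: joined_trans (joined_split d) _.
rewrite expnS mul2n -addnn nseqD -addSnnS.
exact: (joined_cat (ds := [:: d.+1]) (es := [:: d.+1])).
Qed.

Lemma joined_nseq ds D : (forall d, d \in ds -> (d <= D)%N) ->
  exists2 m, joined ds (nseq m D) & tot R ds = m%:R / 2 ^+ D.
Proof.
elim: ds => [|d ds IH] hD.
  by exists 0%N; [exact: joined_refl|rewrite tot_nil mul0r].
have [|m hm ht] := IH; first by move=> k kds; apply: hD; rewrite inE kds orbT.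
have dD : (d <= D)%N by apply: hD; rewrite mem_head.
exists (2 ^ (D - d) + m)%N.
  rewrite nseqD; apply: (joined_cat (ds := [:: d])) => //.
  by have := joined_uniform d (D - d); rewrite subnKC.
rewrite tot_cons ht natrD mulrDl natrX; congr (_ + _).
by rewrite -{2}(subnK dD) exprD invfM mulrA divff ?mul1r// expf_neq0.
Qed.

(** Both subdivisions are refined to pieces of the same depth [D]; equality of the total lengths
    gives the same number of pieces. *)
Lemma joined_tot ds ds' : tot R ds = tot R ds' -> joined ds ds'.
Proof.
move=> e; pose D := \max_(d <- ds ++ ds') d.
have hD d : d \in ds ++ ds' -> (d <= D)%N.
  by move=> hd; apply: (@leq_bigmax_seq _ _ xpredT id).
have [|m h1 t1] := @joined_nseq ds D; first by move=> d h; apply: hD; rewrite mem_cat h.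
have [|m' h2 t2] := @joined_nseq ds' D; first by move=> d h; apply: hD; rewrite mem_cat h orbT.
have mm : m = m'.
  apply/eqP; rewrite -(eqr_nat R); apply/eqP.
  by apply: (mulIf (lt0r_neq0 (exp2V_gt0 R D))); rewrite -t1 -t2.
by apply: joined_trans h1 _; rewrite mm; apply: joined_sym.
Qed.

(* A path [L = B_0, ..., B_n = M], written in consecutive fundamental domains
   scaled by [2^-a] and compared with its translate by one domain. *)
Lemma cpath_left_blocks a c L M : cpath c L M -> exists n X Y,
  adj c X Y /\ deepen (a * n.+1) L ++ Y = deepen a (X ++ M).
Proof.
elim=> [Q|c1 c2 L' P M' h _ [n [X [Y [hXY e]]]]].
  by exists 0%N, [::], [::]; rewrite muln1 cats0; split=> //; exact: adj_refl.
exists n.+1, (deepen (a * n.+1) L' ++ X), (deepen (a * n.+1) P ++ Y); split.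
  by apply: adj_cat => //; apply: adj_deepen.
by rewrite -catA deepen_cat -e -deepenD -mulnS.
Qed.

(** The mirror image near 1, where the domains shrink to the right: [X] is made of the blocks [B_i]
    and [Y] of the blocks [B_(i+1)], both scaled by [2^-(b i)]. All blocks move at once, so the
    squared costs add up to [c]. *)
Lemma cpath_right_blocks b c L M : cpath c L M -> exists n X Y,
  adj c X Y /\ L ++ deepen b Y = X ++ deepen (b * n) M.
Proof.
elim=> [Q|c1 c2 L' P M' h _ [n [X [Y [hXY e]]]]].
  exists 0%N, [::], [::]; rewrite muln0 deepen0 cats0; split=> //; exact: adj_refl.
exists n.+1, (L' ++ deepen b X), (P ++ deepen b Y); split.
  by apply: adj_cat => //; apply: adj_deepen.
by rewrite e deepen_cat -deepenD -mulnS catA.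
Qed.

Lemma cost_segment T x y : is_pt (lpt T) x -> is_pt (rpt T) y ->
  chain x y (Num.sqrt (cost T)).
Proof.
move=> [n [f [t [nE fE tE ->]]]] [m [h [u [mE hE uE ->]]]].
have nm : m = n by rewrite nE mE !size_map.
clear mE; subst m.
have fh : f = h.
  apply: thompson_eq; rewrite fE hE; congr plf.
  by rewrite /depths -!map_comp.
rewrite fh; suff -> : Num.sqrt (cost T) = cube_dist t u by apply: chain_segment.
congr Num.sqrt; rewrite /cost (big_nth (0%N, (0, 0))).
have nE' : size T = n by rewrite nE size_map.
rewrite nE' big_mkord; apply: eq_bigr => i _.
by rewrite tE uE !(nth_map (0%N, (0, 0))) ?nE'.
Qed.

Lemma adj_chain c L M x : adj c L M -> valid L -> is_pt L x ->
  [/\ valid M & exists y l, [/\ is_pt M y, chain x y l & l <= Num.sqrt c]].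
Proof.
move=> [T [_ cM h1 h2 h3]] vL hx.
have vl := iffLR (eqv_valid h1) vL.
have vr : valid (rpt T).
  split; last by rewrite (eqv_cval h2).
    by have [<- _] := vl; congr tot; rewrite /depths -!map_comp.
have vM := iffLR (eqv_valid h2) vr.
have hl := eqv_pt h1 vL hx.
have [y hy] := valid_pt vr.
split=> //; exists y, (Num.sqrt (cost T)); split.
- exact: eqv_pt h2 vr hy.
- exact: cost_segment.
- exact: ler_wsqrtr.
Qed.

Lemma steps_chain N e L M x : steps N e L M -> valid L -> is_pt L x ->
  exists y l, [/\ is_pt M y, chain x y l & l <= N%:R * Num.sqrt e].
Proof.
elim: N L x => [|N IH] L x /=.
  move=> <- _ hx; exists x, 0; rewrite mul0r; split=> //; exact: chain_refl.
move=> [P h h'] vL hx; have [vP [y [l [hy c1 l1]]]] := adj_chain h vL hx.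
have [z [k [hz c2 l2]]] := IH _ _ h' vP hy.
exists z, (l + k); split=> //; first exact: chain_trans c1 c2.
by rewrite -natr1 mulrDl mul1r; lra.
Qed.

Lemma cpath_chain c L M x : cpath c L M -> valid L -> is_pt L x ->
  exists y l, is_pt M y /\ chain x y l.
Proof.
move=> h; elim: h x => [Q x _ hx|c1 c2 L' P M' h _ IH x vL hx].
  by exists x, 0; split=> //; apply: chain_refl.
have [vP [y [l [hy cl _]]]] := adj_chain h vL hx.
have [z [k [hz ck]]] := IH _ vP hy; exists z, (l + k); split=> //.
exact: chain_trans cl ck.
Qed.

End ListPoints.

(** * Connectedness, and the action *)

Section Action.
Variable R : realType.
Implicit Types (x y z : Defs.X R) (g h : thompson R 1).

Lemma to_X_surj x : exists n (f : thompson R n) t, x = to_X (CubePoint f t).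
Proof.
have : to_X (rep_X x) = x by apply: reprK.
by case: (rep_X x) => n f t <-; exists n, f, t.
Qed.

Lemma act_cancel g h : (forall u, 0 <= u <= 1 -> g (h u) = u) ->
  cancel (act g) (act h).
Proof.
move=> gh x; have [n [f [t ->]]] := to_X_surj x.
by rewrite !act_to_X /act_point /= thompson_cancel.
Qed.

Lemma act_chain g x y l : chain x y l -> chain (act g x) (act g y) l.
Proof.
elim=> [|w k n f t u _ h wE]; first exact: chain_refl.
by rewrite act_to_X; apply: chain_step h _; rewrite wE act_to_X.
Qed.

Lemma act_isometry g : isometryX (act g).
Proof.
have [h [hg gh]] := thompson_inverse g.
have c1 := act_cancel gh; have c2 := act_cancel hg.
split; first by exists (act h).
move=> x y; congr inf; apply/seteqP; split=> l /=.
  by move=> /(act_chain h); rewrite !c1.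
exact: act_chain.
Qed.

Definition linked x y := exists l, chain x y l.

Lemma linked_trans x y z : linked x y -> linked y z -> linked x z.
Proof. by move=> [l h] [k h']; exists (l + k); apply: chain_trans h h'. Qed.

Lemma linked_sym x y : linked x y -> linked y x.
Proof. by move=> [l h]; exists l; apply: chain_sym. Qed.

Lemma linked_cube n (f : thompson R n) t u :
  linked (to_X (CubePoint f t)) (to_X (CubePoint f u)).
Proof. by eexists; apply: chain_segment. Qed.

Lemma chi_subproof n (J : {set 'I_n}) i : 0 <= chi R J 0 i <= 1.
Proof. by rewrite mxE; case: (i \in J); rewrite ?lexx ?ler01. Qed.

Definition corner n (J : {set 'I_n}) : unit_cube R n := UnitCube (chi_subproof J).

Lemma stretch_setT n (y : R) : 0 <= y <= n%:R ->
  stretch [set: 'I_n]%SET y = 2 * y :> R.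
Proof.
move=> /andP[y0 yn]; suff h k : \sum_(i < k) Num.max 0 (Num.min 1 (y - i%:R)) = Num.min y k%:R.
  rewrite /stretch (eq_bigl xpredT) => [|i]; last by rewrite finset.in_setT.
  by rewrite h min_l//; ring.
elim: k => [|k IH]; first by rewrite big_ord0 min_r.
have k0 := ler0n R k; rewrite big_ord_recr /= IH -natr1.
by case: clampP => ?; do 2!case: leP => ?; lra.
Qed.

(** The corner of [C(f)] opposite to the origin is labeled [2 f]; crossing [k] such cubes leads to
    [2^k f]. *)
Lemma doubling n (f : thompson R n) k : exists m (h : thompson R m),
  h = (fun u => 2 ^+ k * f u) :> (R -> R) /\
  linked (to_X (CubePoint f (corner finset.set0))) (to_X (CubePoint h (corner finset.set0))).
Proof.
elim: k => [|k [m [h [hE hl]]]].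
  exists n, f; split; last exact: linked_cube.
  by apply: funext => u; rewrite mul1r.
exists (m + #|[set: 'I_m]%SET|)%N, (bracket h [set: 'I_m]%SET); split.
  apply: funext => u /=; suff hu : 0 <= h u <= m%:R.
    by rewrite stretch_setT// hE exprS mulrA.
  have [u0|u0] := leP u 0.
    by rewrite (thompson_le0 h u0) thompson_0 lexx ler0n.
  have [u1|u1] := leP 1 u.
    by rewrite (thompson_ge1 h u1) thompson_1 lexx ler0n.
  by apply: thompson_range; rewrite !ltW.
apply: linked_trans hl _; apply: linked_trans (linked_cube _ _ (corner [set: 'I_m]%SET)) _.
suff <- : to_X (CubePoint h (corner [set: 'I_m]%SET)) =
   to_X (CubePoint (bracket h [set: 'I_m]%SET) (corner finset.set0)).
  exact: linked_cube.
by apply: glue_vertex => // i; rewrite mxE ?finset.inE.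
Qed.

Lemma plf_units (p : R) n u : p <= u <= p + n%:R -> plf p (nseq n 0%N) u = u - p.
Proof.
elim: n p => [|n IH] p /=; first by rewrite addr0 => hu; lra.
rewrite -natr1 invr1 => hu; have [up|pu] := leP u (p + 1).
  by rewrite piece_mid ?plf_low ?invr1//; lra.
rewrite piece_high ?invr1 ?IH//; lra.
Qed.

Lemma exp2z_le1 (z : int) : 2 ^ z <= 1 :> R -> exists d : nat, z = - d%:Z.
Proof.
case: z => [[|m]|m] hz; first by exists 0%N.
  by move: hz; rewrite -exprnP leNgt exprn_egt1 ?ltr1n.
by exists m.+1; rewrite NegzE.
Qed.

(** For large [k] the inverse of [f] is affine on the grid of mesh [2^-k], so [2^k f] maps
    consecutive intervals of dyadic lengths affinely onto unit intervals. The list [ds] is built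
    from left to right. *)
Lemma subdivision n (f : thompson R n) : exists k ds,
  tot R ds = 1 /\ (fun u => 2 ^+ k * f u) = plf 0 ds :> (R -> R).
Proof.
have [h [hpl hf fh]] := pl_inverse (thompson_pl f).
have [k /(_ k (leqnn _)) hk] := pl_fine hpl.
have k2 := exp2_gt0 R k.
pose v (i : nat) := h (i%:R / 2 ^+ k).
pose F u := 2 ^+ k * f u.
have P m : (m <= n * 2 ^ k)%N -> exists ds,
    tot R ds = v m /\ carries F 0 ds 0 (nseq m 0%N).
  elim: m => [|m IH] mn.
    exists [::]; rewrite tot_nil /v mul0r (pl0 hpl); split=> //=.
    by rewrite /F thompson_0 mulr0.
  have [ds [tv cv]] := IH (ltnW mn); have [z hz] := hk m mn.
  have mS : m.+1%:R / 2 ^+ k = m%:R / 2 ^+ k + 2 ^- k :> R.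
    by rewrite -natr1 mulrDl mul1r.
  have ek := exp2V_gt0 R k.
  have vS : v m.+1 = v m + 2 ^ z * 2 ^- k by rewrite /v mS hz ?lexx ?ltW.
  have in0n i : (i <= n * 2 ^ k)%N -> 0 <= (i%:R / 2 ^+ k : R) <= n%:R.
    by move=> hi; rewrite divr_ge0 ?ler0n ?(ltW k2)//= ler_pdivrMr// -natrX -natrM ler_nat.
  have /andP[vm0 _] := pl_range hpl (in0n _ (ltnW mn)).
  have /andP[_ vm1] := pl_range hpl (in0n _ mn).
  have zk : 2 ^ z * 2 ^- k = 2 ^ (z - k%:Z) :> R by rewrite exp2zD exprnN.
  (* The preimage of a grid interval lies in [[0, 1]], so its length is at most 1 and the exponent
     is not positive. *)
  have [d dE] : exists d : nat, z - k%:Z = - d%:Z.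
    have vm0' : 0 <= v m := vm0; have vm1' : v m.+1 <= 1 := vm1.
    by apply: exp2z_le1; rewrite -zk; move: vm0' vm1'; rewrite vS; lra.
  have dv : 2 ^- d = 2 ^ z * 2 ^- k :> R by rewrite zk dE exprnN.
  exists (rcons ds d); rewrite -cats1 tot_cat tot_cons tot_nil addr0 tv vS dv.
  split=> //; have -> : nseq m.+1 0%N = nseq m 0%N ++ [:: 0%N] by rewrite -[m.+1]addn1 nseqD.
  have tn : tot R (nseq m 0%N) = m%:R.
    by rewrite /tot big_nseq iter_addr_0 expr0 invr1.
  have e2 : 2 ^ z * 2 ^ (- z) = 1 :> R := exp2zK R z.
  have FE s : 0 <= s <= 2 ^- d -> F (v m + s) = m%:R + 2 ^+ d * s.
    move=> /andP[s0 s1].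
    have t0 : 0 <= 2 ^ (- z) * s by rewrite mulr_ge0 ?(ltW (exp2z_gt0 _ _)).
    have t1 : 2 ^ (- z) * s <= 2 ^- k.
      rewrite -(ler_pM2l (exp2z_gt0 R z)) mulrA e2 mul1r -dv; lra.
    have -> : v m + s = h (m%:R / 2 ^+ k + 2 ^ (- z) * s).
      by rewrite hz ?t0// mulrA e2 mul1r.
    have /andP[i1 i2] := in0n _ (ltnW mn); have /andP[i3 i4] := in0n _ mn.
    rewrite /F fh; last by rewrite mS in i4; lra.
    rewrite mulrDr mulrCA divff ?mulr1 ?gt_eqF//; congr (_ + _).
    rewrite mulrA; congr (_ * _); apply: (mulIf (lt0r_neq0 (exp2V_gt0 R d))).
    rewrite exp2K dv; have k1 := exp2K R k; ring: e2 k1.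
  apply: carries_cat cv _; rewrite add0r tv tn add0r /=; split.
    by move=> s hs; rewrite FE// divr1.
  rewrite FE; first by rewrite exp2K expr0 invr1.
  by rewrite lexx ltW ?exp2V_gt0.
have [ds [tv cv]] := P _ (leqnn _).
have vN : v (n * 2 ^ k)%N = 1.
  by rewrite /v natrM natrX mulfK ?gt_eqF// (pl_end hpl).
exists k, ds; rewrite tv vN; split=> //; apply: funext => u.
have in01 w : 0 <= w <= 1 -> F w = plf 0 ds w.
  move=> hw; rewrite -(carries_plf cv) ?tv ?vN ?add0r// plf_units ?subr0//.
  have /andP[f0 fn] := thompson_range f hw.
  by rewrite /F add0r mulr_ge0 ?(ltW k2)//= natrM natrX mulrC ler_pM2r.
have [u0|u0] := leP u 0.
  by rewrite (thompson_le0 f u0) plf_le0// -in01// lexx ler01.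
have [u1|u1] := leP 1 u.
  by rewrite (thompson_ge1 f u1) plf_ge1// ?tv// -in01// lexx ler01.
by rewrite -in01// !ltW.
Qed.

(** Any point is linked to some [2^k f] given by a subdivision, and [joined_tot] links that to the
    trivial subdivision. Thus the infimum defining [distX] is over a nonempty set. *)
Lemma linked_all x y : linked x y.
Proof.
have v0 : valid (zl R [:: 0%N]).
  by split; rewrite ?cval_zl// depths_zl tot_cons tot_nil expr0 invr1 addr0.
have [x0 hx0] := valid_pt v0.
suff h w : linked w x0 by apply: linked_trans (h x) (linked_sym (h y)).
have [n [f [t ->]]] := to_X_surj w.
apply: linked_trans (linked_cube _ _ (corner finset.set0)) _.
have [k [ds [t1 fds]]] := subdivision f.
have [m [h [hE hl]]] := doubling f k.
apply: linked_trans hl _.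
have hv : valid (zl R ds) by split; rewrite ?cval_zl ?depths_zl.
have hE' : h = plf 0 ds :> (R -> R) by rewrite hE; exact: fds.
have mE : m = size ds.
  by apply/eqP; rewrite -(eqr_nat R) -(thompson_1 h) hE' plf_high ?t1 ?add0r.
have hp : is_pt (zl R ds) (to_X (CubePoint h (corner finset.set0))).
  exists m, h, (corner finset.set0); split=> //.
  - by rewrite size_map.
  - by rewrite depths_zl.
  - by move=> i; rewrite mxE finset.inE (nth_map 0%N) ?mE// -mE.
have [|c _ hc] := @joined_tot R ds [:: 0%N] _ 1 ltr01.
  by rewrite t1 tot_cons tot_nil expr0 invr1 addr0.
have [y0 [l [hy0 cl]]] := cpath_chain hc hv hp.
by exists l; rewrite -(is_pt_uniq hy0 hx0).
Qed.

End Action.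

(** * Lower bound *)

Section LowerBound.
Variable R : realType.

(** Comparing the vertices [J] and [i |: J] shows that the coefficient of each free coordinate [i]
    vanishes. *)
Lemma affine_face n (a : R) (c : 'I_n -> R) (J K : {set 'I_n}) (v : 'rV[R]_n) :
  J \subset K ->
  (forall I : {set 'I_n}, J \subset I -> I \subset K ->
     a + \sum_i c i * chi R I 0 i = 0) ->
  face J K v -> a + \sum_i c i * v 0 i = 0.
Proof.
move=> JK h hv; apply: etrans (h J (subxx _) JK); congr (_ + _).
apply: eq_bigr => i _.
have [_ h1 h0] := hv i; rewrite mxE.
have [iJ|iJ] := boolP (i \in J); first by rewrite h1.
have [iK|iK] := boolP (i \in K); last by rewrite h0.
suff -> : c i = 0 by rewrite !mul0r.
have hi := h (i |: J)%SET; have hJ := h J (subxx _) JK.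
have : a + \sum_i0 c i0 * chi R (i |: J)%SET 0 i0 = 0.
  by apply: hi; rewrite ?finset.subsetUr// finset.subUset finset.sub1set iK.
rewrite (bigD1 i)//= mxE finset.setU11 mulr1.
move: hJ; rewrite (bigD1 i)//= mxE (negbTE iJ) mulr0 add0r.
rewrite (eq_bigr (fun k => c k * chi R (i |: J)%SET 0 k)); first by lra.
by move=> k ki; rewrite !mxE finset.inE finset.in_set1 (negbTE ki).
Qed.

Lemma cauchy_schwarz n (c d : 'I_n -> R) (Q : R) : 0 <= Q ->
  \sum_i c i ^+ 2 <= Q ^+ 2 ->
  \sum_i c i * d i <= Q * Num.sqrt (\sum_i d i ^+ 2).
Proof.
move=> Q0 cQ; set D := \sum_i d i ^+ 2; set S := \sum_i c i * d i.
have D0 : 0 <= D by apply: sumr_ge0 => i _; apply: sqr_ge0.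
have [SN|S0] := leP S 0.
  by apply: (le_trans SN); rewrite mulr_ge0// sqrtr_ge0.
have key : 0 <= D * (D * (\sum_i c i ^+ 2) - S ^+ 2).
  have : 0 <= \sum_i (D * c i - S * d i) ^+ 2.
    by apply: sumr_ge0 => i _; apply: sqr_ge0.
  rewrite (eq_bigr (fun i => D ^+ 2 * c i ^+ 2 + (- (2 * D * S)) * (c i * d i)
     + S ^+ 2 * d i ^+ 2)); last by move=> i _; ring.
  rewrite !big_split /= -!mulr_sumr -/D -/S; lra.
have DS : S ^+ 2 <= D * \sum_i c i ^+ 2.
  move: D0; rewrite le_eqVlt => /orP[/eqP D0|D0].
    suff S0' : S = 0 by rewrite S0' ltxx in S0.
    rewrite /S big1// => i _; suff -> : d i = 0 by rewrite mulr0.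
    move/esym/eqP: D0; rewrite psumr_eq0; last by move=> k _; apply: sqr_ge0.
    by move=> /allP/(_ i (mem_index_enum _)); rewrite sqrf_eq0 => /eqP.
  by move: key; rewrite pmulr_rge0// subr_ge0.
rewrite -(ler_pXn2r (n := 2)) ?nnegrE ?mulr_ge0 ?sqrtr_ge0//; last exact: ltW.
rewrite exprMn sqr_sqrtr//; apply: (le_trans DS); rewrite mulrC; exact: ler_wpM2r.
Qed.

(** * The functions affine on cubes *)

Section Psi.
Variables al be ga : R.

Definition coef n (i : 'I_n) : R :=
  if n == 1%N then ga else
  if i == 0%N :> nat then al else if i.+1 == n then be else ga.

(** For [F] in [F_n] with [n >= 2], splitting the first, the last or another interval raises the
    value by [al], [be] or [ga]. For [n = 1] the only split raises both slopes, and the last term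
    compensates so that the value rises by [ga]. *)
Definition vertex_value (F : R -> R) : R :=
  (al - ga) * (slope0 F)%:~R + (be - ga) * (slope1 F)%:~R + ga * F 1
  + (F 1 == 1)%:R * (al - ga + (be - ga)).

(* Weighs the logarithms of the slopes at 0 and 1 by [al] and [be], and the rest
   of the subdivision by [ga]. The only cubes whose first and last intervals
   coincide are the edges [C f] with [f] in [F_1]; these are dangling, so the
   first two terms may be taken constant on them. *)
Definition psi (p : cube_point R) : R :=
  vertex_value (cp_cube p) + \sum_i coef i * cp_coord p 0 i.

Lemma coef_sqr n : (0 < n)%N ->
  \sum_(i < n) coef i ^+ 2 <= al ^+ 2 + be ^+ 2 + n%:R * ga ^+ 2.
Proof.
case: n => // n _; have -> : al ^+ 2 + be ^+ 2 + n.+1%:R * ga ^+ 2 =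
   \sum_(i < n.+1) ((i == ord0)%:R * al ^+ 2 + (i == ord_max)%:R * be ^+ 2 + ga ^+ 2).
  rewrite !big_split /= sumr_const card_ord -!mulr_suml -[ga ^+ 2 *+ _]mulr_natl.
  have one (k : 'I_n.+1) : \sum_(i < n.+1) (i == k)%:R = 1 :> R.
    by rewrite (bigD1 k)//= eqxx big1 ?addr0// => i /negbTE ->.
  by rewrite !one !mul1r.
apply: ler_sum => i _; rewrite /coef -!val_eqE /= !eqSS.
have := sqr_ge0 al; have := sqr_ge0 be; have := sqr_ge0 ga.
case: (n == 0)%N; case: (val i == 0)%N; case: (val i == n)%N;
  by rewrite ?mulr1n ?mulr0n ?mul1r ?mul0r; lra.
Qed.

Lemma psi_vertex n (f : thompson R n) (I : {set 'I_n}) :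
  vertex_value f + \sum_i coef i * chi R I 0 i = vertex_value (bracket f I).
Proof.
have n0 := thompson_dim_gt0 f.
have f1 := thompson_1 f; have b1 := thompson_1 (bracket f I).
pose j0 := Ordinal n0.
have n1 : (n.-1 < n)%N by rewrite prednK.
pose j1 := Ordinal n1.
have g0 := slope0E (germ0_stretch f I (j := j0) erefl).
have g1 := slope1E (germ1_stretch f I (j := j1) (prednK n0)).
have cE : \sum_i coef i * chi R I 0 i = \sum_(i in I) coef i.
  rewrite [RHS]big_mkcond; apply: eq_bigr => i _; rewrite mxE.
  by case: (i \in I); rewrite ?mulr1 ?mulr0.
rewrite cE /vertex_value b1 f1 /= g0 g1 !intrD.
have eq1 k : (k%:R == 1 :> R) = (k == 1)%N by rewrite -(eqr_nat R).
rewrite !eq1 natrD.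
have [nE|n1'] := eqVneq n 1%N.
  have -> : j1 = j0 by apply: val_inj; rewrite /= nE.
  have cI : \sum_(i in I) coef i = ga *+ #|I|.
    by rewrite -sumr_const; apply: eq_bigr => i _; rewrite /coef (introT eqP nE).
  have Icard : #|I| = (j0 \in I).
    have I1 : (#|I| <= 1)%N by apply: leq_trans (max_card _) _; rewrite card_ord nE.
    have [jI|jI] := boolP (j0 \in I).
      by apply/eqP; rewrite eqn_leq I1 card_gt0; apply/set0Pn; exists j0.
    apply/eqP; rewrite cards_eq0 -finset.subset0; apply/fintype.subsetP => i iI.
    have ij : i = j0 by apply: val_inj => /=; have := leq_trans (ltn_ord i) (eq_leq nE); case: (val i).
    by rewrite -ij iI in jI.
  have nR : n%:R = 1 :> R by rewrite nE.
  rewrite cI Icard -[ga *+ _]mulr_natr nR; move: (j0 \in I) => bI.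
  have -> : (n + bI == 1)%N = ~~ bI by rewrite nE; case: bI.
  by case: bI => /=; ring.
have -> : (n + #|I| == 1)%N = false by apply/negbTE; lia.
have c2 : \sum_(i in I) coef i =
   \sum_(i in I) (((i == j0)%:R * (al - ga)) + ((i == j1)%:R * (be - ga)) + ga).
  apply: eq_bigr => i _; rewrite /coef (negbTE n1') -!val_eqE /=.
  have -> : (i == n.-1 :> nat) = (i.+1 == n) by apply/eqP/eqP; lia.
  case: (val i =P 0%N) => i0; case: ((val i).+1 =P n) => i1 /=; try ring.
  by move: n1'; rewrite -i1 i0.
have one (k : 'I_n) : \sum_(i in I) (i == k)%:R = (k \in I)%:R :> R.
  have [kI|kI] := boolP (k \in I).
    by rewrite (bigD1 k)//= eqxx big1 ?addr0// => i /andP[_ /negbTE ->].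
  by rewrite big1// => i iI; case: eqP => // ik; rewrite -ik iI in kI.
rewrite c2 !big_split /= -!mulr_suml !one sumr_const -[ga *+ _]mulr_natr.
by case: (j0 \in I); case: (j1 \in I) => /=; ring.
Qed.

(** On the glued face, the difference of the two expressions is affine; it vanishes at the vertices
    since by [psi_vertex] their values depend only on the labels. *)
Lemma psi_glue p q : Defs.glue p q -> psi p = psi q.
Proof.
move=> [J [K [J' [K' [phi [[JK _ [A [b phiE]] _ hI] ft phit]]]]]].
have affE (v : 'rV[R]_(cp_dim p)) : (vertex_value (cp_cube p) - vertex_value (cp_cube q) - \sum_k coef k * b 0 k)
    + \sum_i (coef i - \sum_k A i k * coef k) * v 0 i
  = vertex_value (cp_cube p) + \sum_i coef i * v 0 i
    - (vertex_value (cp_cube q) + \sum_k coef k * phi v 0 k).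
  rewrite (eq_bigr (fun i => coef i * v 0 i - v 0 i * \sum_k A i k * coef k)); last first.
    by move=> i _; ring.
  rewrite [in RHS](eq_bigr (fun k => coef k * b 0 k + \sum_i v 0 i * (A i k * coef k))); last first.
    move=> k _; rewrite phiE !mxE mulrDr addrC mulr_sumr; congr (_ + _).
    by apply: eq_bigr => i _; ring.
  rewrite sumrB big_split /= exchange_big /=.
  rewrite [X in _ - _ + (_ - X)](eq_bigr (fun i => \sum_k v 0 i * (A i k * coef k))).
    by ring.
  by move=> i _; rewrite mulr_sumr.
apply/eqP; rewrite -subr_eq0 /psi -phit -affE; apply/eqP.
apply: affine_face JK _ ft => I JI IK; rewrite affE.
have [I' [_ _ -> e]] := hI I JI IK.
by rewrite !psi_vertex e subrr.
Qed.

Definition psiX (x : Defs.X R) : R := psi (rep_X x).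

Lemma psiX_to_X p : psiX (to_X p) = psi p.
Proof. by apply: (to_X_ind psi_glue); apply: reprK. Qed.

Lemma psiX_act g x : psiX (act g x) =
  psiX x + ((al - ga) * (slope0 g)%:~R + (be - ga) * (slope1 g)%:~R).
Proof.
have [n [f [t ->]]] := to_X_surj x.
rewrite act_to_X !psiX_to_X /psi /= /vertex_value /=.
rewrite (slope0E (germ0_comp f g)) (slope1E (germ1_comp f g)) (thompson_1 g) !rmorphD /=.
ring.
Qed.

Lemma psiX_segment n (f : thompson R n) (t u : unit_cube R n) Q : 0 <= Q ->
  al ^+ 2 + be ^+ 2 + n%:R * ga ^+ 2 <= Q ^+ 2 ->
  psiX (to_X (CubePoint f u)) - psiX (to_X (CubePoint f t)) <= Q * cube_dist t u.
Proof.
move=> Q0 hQ; rewrite !psiX_to_X /psi /= opprD addrACA subrr add0r -sumrB.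
rewrite (eq_bigr (fun i => coef i * (u 0 i - t 0 i))); last by move=> i _; ring.
rewrite cube_distC; apply: cauchy_schwarz Q0 _.
exact: le_trans (coef_sqr (thompson_dim_gt0 f)) hQ.
Qed.

End Psi.

(** * Control of the dimension of the cubes along a path *)

Definition level := psiX 1 1 1.

Lemma levelE n (f : thompson R n) (t : unit_cube R n) :
  level (to_X (CubePoint f t)) = n%:R + \sum_i t 0 i.
Proof.
rewrite /level psiX_to_X /psi /vertex_value /= subrr !mul0r thompson_1 addr0.
rewrite mulr0 addr0 !add0r mul1r; congr (_ + _); apply: eq_bigr => i _.
by rewrite /coef !if_same mul1r.
Qed.

Lemma level_ge_dim n (f : thompson R n) (t : unit_cube R n) :
  n%:R <= level (to_X (CubePoint f t)).
Proof.
by rewrite levelE lerDl; apply: sumr_ge0 => i _; have /andP[] := cube_coordP t i.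
Qed.

(** On an [n]-dimensional cube the gradient of the level has norm [sqrt n], at most the square root
    of the level, so that square root has gradient of norm at most [1/2]. *)
Lemma level_segment n (f : thompson R n) (t u : unit_cube R n) :
  Num.sqrt (level (to_X (CubePoint f u))) <=
  Num.sqrt (level (to_X (CubePoint f t))) + cube_dist t u / 2.
Proof.
have ht := level_ge_dim f t; have hu := level_ge_dim f u.
have n0 : (1 : R) <= n%:R by rewrite ler1n (thompson_dim_gt0 f).
set P := level _ in hu *; set Q := level _ in ht *.
have hd : P - Q <= Num.sqrt n%:R * cube_dist t u.
  rewrite /P /Q !levelE opprD addrACA subrr add0r -sumrB.
  rewrite (eq_bigr (fun i => 1 * (u 0 i - t 0 i))); last by move=> i _; ring.
  rewrite cube_distC; apply: cauchy_schwarz; first exact: sqrtr_ge0.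
  rewrite sqr_sqrtr ?ler0n// (eq_bigr (fun=> 1)); last by move=> i _; rewrite expr1n.
  by rewrite sumr_const card_ord.
have P0 : 0 <= P by lra. 
have Q0 : 0 <= Q by lra.
have sP : Num.sqrt n%:R <= Num.sqrt P by apply: ler_wsqrtr.
have sQ : Num.sqrt n%:R <= Num.sqrt Q by apply: ler_wsqrtr.
have s1 : 0 < Num.sqrt n%:R :> R by rewrite sqrtr_gt0; lra.
have d0 := cube_dist_ge0 t u.
rewrite -(sqr_sqrtr P0) -(sqr_sqrtr Q0) in hd.
move: hd sP sQ s1 d0; set p := Num.sqrt P; set q := Num.sqrt Q.
set r := Num.sqrt _; set d := cube_dist _ _ => hd rp rq r0 d0.
(* If [p - q > d / 2], then [p + q >= 2 r > 0] gives [p^2 - q^2 > r d], against [hd]. *)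
rewrite leNgt; apply/negP => pq; nra.
Qed.

Lemma level_chain x y l : chain x y l ->
  Num.sqrt (level y) <= Num.sqrt (level x) + l / 2.
Proof.
elim=> [|w k n f t u _ h wE]; first by rewrite mul0r addr0.
by have := level_segment f t u; rewrite -wE; lra.
Qed.

(** The dimension of a cube is at most the level of its points, so [N] bounds the dimensions of all
    cubes met by a chain of length at most [L] from [x], and [Q] is a Lipschitz constant on each of
    them. *)
Lemma psiX_chain (al be ga N Q L : R) x y l : 0 <= Q ->
  (Num.sqrt (level x) + L / 2) ^+ 2 <= N ->
  al ^+ 2 + be ^+ 2 + N * ga ^+ 2 <= Q ^+ 2 ->
  chain x y l -> l <= L -> psiX al be ga y - psiX al be ga x <= Q * l.
Proof.
move=> Q0 hN hQ; elim=> [|w k n f t u hc IH wE] hl.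
  by rewrite subrr mulr0.
have d0 := cube_dist_ge0 t u; have k0 := chain_ge0 hc.
have hk : k <= L by lra.
have nN : n%:R <= N.
  apply: le_trans hN; have lv := level_chain hc.
  have dn := level_ge_dim f t; rewrite -wE in dn.
  have l0 : 0 <= level w by apply: le_trans dn; apply: ler0n.
  apply: (le_trans dn); rewrite -(sqr_sqrtr l0) ler_pXn2r ?nnegrE ?sqrtr_ge0//; first by lra.
  have := sqrtr_ge0 (level x); lra.
have seg : al ^+ 2 + be ^+ 2 + n%:R * ga ^+ 2 <= Q ^+ 2.
  apply: le_trans hQ; rewrite lerD2l ler_wpM2r// sqr_ge0//.
have := psiX_segment f t u Q0 seg; rewrite -wE => h2.
by have := IH hk; rewrite mulrDr; lra.
Qed.

(** * Lower bounds for the displacement of [g] *)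

Variable g : thompson R 1.
Let a : R := (slope0 g)%:~R.
Let b : R := (slope1 g)%:~R.

Lemma distX_act_ge x : Num.sqrt (a ^+ 2 + b ^+ 2) <= distX (act g x) x.
Proof.
apply: distX_ge; first exact: linked_all.
move=> l /chain_sym c; have l0 := chain_ge0 c.
set c0 := Num.sqrt _; have c00 : 0 <= c0 := sqrtr_ge0 _.
have cc : c0 ^+ 2 = a ^+ 2 + b ^+ 2 by rewrite sqr_sqrtr// addr_ge0 ?sqr_ge0.
(* With weights [(a, b, 0)] the function is [c0]-Lipschitz whatever the dimension, and [g]
   translates it by [c0^2]. *)
have := @psiX_chain a b 0 _ c0 l x _ l c00 (lexx _) _ c (lexx _).
rewrite psiX_act !subr0 expr0n mulr0 addr0 -cc => /(_ (lexx _)).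
rewrite addrAC subrr add0r expr2 => h.
move: c00; rewrite le_eqVlt => /orP[/eqP <-//|c0p].
by move: h; rewrite ler_pM2l.
Qed.

Lemma distX_act_gt x : a + b != 0 ->
  Num.sqrt (a ^+ 2 + b ^+ 2) < distX (act g x) x.
Proof.
move=> ab; set c0 := Num.sqrt _; have c00 : 0 <= c0 := sqrtr_ge0 _.
have cc : c0 ^+ 2 = a ^+ 2 + b ^+ 2 by rewrite sqr_sqrtr// addr_ge0 ?sqr_ge0.
(* Chains longer than [c0 + 1] already satisfy the bound; [N] is the bound on dimensions for the
   others. *)
pose N := (Num.sqrt (level x) + (c0 + 1) / 2) ^+ 2.
have N0 : 0 < N by rewrite exprn_gt0//; have s0 := sqrtr_ge0 (level x); lra.
pose Q := Num.sqrt (a ^+ 2 + b ^+ 2 + (a + b) ^+ 2 / N).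
have e0 : 0 < (a + b) ^+ 2 / N by rewrite divr_gt0// exprn_even_gt0.
have QQ : Q ^+ 2 = a ^+ 2 + b ^+ 2 + (a + b) ^+ 2 / N.
  by rewrite sqr_sqrtr// -cc; have := sqr_ge0 c0; lra.
have c0Q : c0 < Q.
  by rewrite /c0 /Q ltr_sqrt ?ltrDl// -cc; have := sqr_ge0 c0; lra.
suff : Num.min Q (c0 + 1) <= distX (act g x) x.
  by apply: lt_le_trans; rewrite lt_min c0Q ltrDl ltr01.
apply: distX_ge; first exact: linked_all.
move=> l /chain_sym c; have [lL|Ll] := leP l (c0 + 1); last first.
  by rewrite ge_min (ltW Ll) orbT.
rewrite ge_min; apply/orP; left.
have Q0 : 0 < Q by apply: le_lt_trans c0Q.
(* For this third weight the translation and the square of the Lipschitz constant both equal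
   [Q^2]. *)
have := @psiX_chain a b (- ((a + b) / N)) N Q _ x _ l (ltW Q0) (lexx _) _ c lL.
have -> : a ^+ 2 + b ^+ 2 + N * (- ((a + b) / N)) ^+ 2 = Q ^+ 2.
  by rewrite QQ; field; apply: lt0r_neq0.
move=> /(_ (lexx _)); rewrite psiX_act addrAC subrr add0r -/a -/b.
have -> : (a - - ((a + b) / N)) * a + (b - - ((a + b) / N)) * b = Q ^+ 2.
  by rewrite QQ; field; apply: lt0r_neq0.
by rewrite expr2 ler_pM2l.
Qed.

End LowerBound.

(** * Dynamics of an expanding element *)

Section Dynamics.
Variable R : realType.
Variable g : thompson R 1.
Implicit Types (u s : R) (k n : nat).

Lemma iter_range k u : 0 <= u <= 1 -> 0 <= iter k g u <= 1.
Proof. by move=> hu; elim: k => // k IH; apply: (thompson_range g). Qed.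

Lemma iter_lt k u s : 0 <= u -> u < s -> s <= 1 -> iter k g u < iter k g s.
Proof.
move=> u0 us s1; elim: k => // k IH /=.
have /andP[i0 _] := iter_range k (u := u) (ltac:(lra)).
have /andP[_ j1] := iter_range k (u := s) (ltac:(lra)).
exact: thompson_lt.
Qed.

Lemma iter_thompson k : exists f : thompson R 1,
  forall u, 0 <= u <= 1 -> f u = iter k g u.
Proof.
elim: k => [|k [f hf]].
  have t1 : tot R [:: 0%N] = 1 by rewrite tot_cons tot_nil expr0 invr1 addr0.
  exists (vert t1) => u hu /=.
  by rewrite addr0 piece_mid ?expr0 ?invr1 ?add0r// mul1r subr0.
exists (thompson_comp g f) => u hu /=; by rewrite hf.
Qed.

Hypothesis g_gt : forall u, 0 < u -> u < 1 -> u < g u.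

Lemma iter_limit u r : 0 < u -> u < 1 -> r < 1 -> exists k, r < iter k g u.
Proof.
move=> u0 u1 r1; apply: contrapT => /forallNP hk.
have {}hk k : iter k g u <= r by rewrite leNgt; apply/negP/hk.
have [h [hg gh]] := thompson_inverse g.
pose E := [set x | exists k, x = iter k g u]%classic.
have E0 : nonempty E by exists u; exists 0%N.
have Er : ubound E r by move=> _ [k ->].
have supE : has_sup E by split=> //; exists r.
set s := sup E; have sr : s <= r by apply: ge_sup.
have us : u <= s by apply: ub_le_sup; [exists r|exists 0%N].
have hs01 : 0 <= s <= 1 by lra.
have ghs := gh _ hs01; have h01 := thompson_range h hs01.
have hs0 : 0 < h s.
  rewrite lt_neqAle; case/andP: h01 => -> _; rewrite andbT eq_sym; apply/eqP => e.
  by move: ghs; rewrite e thompson_0; lra.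
have hs1 : h s < 1.
  rewrite lt_neqAle; case/andP: h01 => _ ->; rewrite andbT; apply/eqP => e.
  by move: ghs; rewrite e thompson_1; lra.
have hss : h s < s by rewrite -{2}ghs; apply: g_gt.
have [|_ [k ->] hk'] := @sup_gt R E (h s) E0; first by rewrite -/s.
have : iter k.+1 g u <= s by apply: ub_le_sup; [exists r|exists k.+1].
rewrite leNgt => /negP; apply; rewrite -ghs /=; apply: thompson_lt => //.
  exact: ltW.
by have := hk k; lra.
Qed.

Variables (a b : nat).
Hypotheses (a_gt0 : (0 < a)%N) (g0 : germ0 g a%:Z) (g1 : germ1 g (- b%:Z)).

Lemma exp2V_small (e : R) : 0 < e -> exists c : nat, 2 ^- c <= e.
Proof.
move=> e0; exists (Num.truncn e^-1).+1.
rewrite -[leRHS]invrK lef_pV2 ?posrE ?exp2_gt0 ?invr_gt0//.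
apply: le_trans (ltW (truncnS_gt _)) _.
by rewrite -natrX ler_nat ltnW// ltn_expl.
Qed.

Lemma exp2V_le c c' : (c <= c')%N -> 2 ^- c' <= 2 ^- c :> R.
Proof. by move=> h; rewrite lef_pV2 ?posrE ?exp2_gt0// ler_weXn2l// ler1n. Qed.

Lemma germ_scales : exists c0 c1 : nat,
  [/\ (0 < c0)%N, (0 < c1)%N, 2 ^- c0 <= 1 - 2 ^- c1 :> R,
     forall u, 0 <= u <= 2 ^- c0 -> g u = 2 ^+ a * u &
     forall u, 0 <= u <= 2 ^- c1 -> g (1 - u) = 1 - 2 ^- b * u].
Proof.
have [e0 e00 h0] := g0; have [e1 e10 h1] := g1.
have [k0 hk0] := exp2V_small e00; have [k1 hk1] := exp2V_small e10.
have d0 := exp2V_le (leqnSn k0); have d1 := exp2V_le (leqnSn k1).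
exists k0.+1, k1.+1; split=> //.
- have i0 := exp2V_le (ltn0Sn k0); have i1 := exp2V_le (ltn0Sn k1).
  have := @exp2V_le 1 k0.+1 isT; have := @exp2V_le 1 k1.+1 isT.
  by rewrite expr1; lra.
- by move=> u hu; rewrite h0 ?exprnP//; lra.
- by move=> u hu; rewrite h1 ?thompson_1 ?exprnN//; lra.
Qed.

Lemma pow2_ratio (c D : nat) : (c <= D)%N -> (2 ^ (D - c))%:R / 2 ^+ D = 2 ^- c :> R.
Proof.
move=> cD; rewrite natrX -[in X in _ / X](subnK cD) exprD invfM mulrA.
by rewrite divff ?mul1r.
Qed.

(* The points [v n] subdivide the fundamental domain [2^-(c0+a), 2^-c0] evenly
   and the other ones by the action of [g]. *)
Lemma itinerary c0 c1 :
  (0 < c0)%N -> (0 < c1)%N -> 2 ^- c0 <= 1 - 2 ^- c1 :> R ->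
  (forall u, 0 <= u <= 2 ^- c0 -> g u = 2 ^+ a * u) ->
  exists (v : nat -> R) (d : nat -> nat) (m n1 : nat),
  [/\ (m <= n1)%N, v 0%N = 2 ^- (c0 + a), v n1 = 1 - 2 ^- c1,
      forall n, v (n + m)%N = g (v n) &
      (forall n, (n < n1 + m)%N -> v n.+1 = v n + 2 ^- d n) /\
      (forall n, (n < n1)%N -> forall s, 0 <= s <= 1 ->
        g (v n + 2 ^- d n * s) = v (n + m)%N + 2 ^- d (n + m)%N * s)].
Proof.
move=> c00 c10 c01 gc0; set p : R := 2 ^- c0; set q : R := 1 - 2 ^- c1.
have p0 : 0 < p := exp2V_gt0 R c0.
have p1 : p < 1 by have := exp2V_gt0 R c1; have := c01; rewrite -/p; lra.
have q1 : q < 1 by have := exp2V_gt0 R c1; rewrite /q; lra.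
have pq : p <= q := c01.
have p2 : 2 ^- (c0 + a) = 2 ^- a * p by rewrite /p exprD invfM mulrC.
have p20 : 0 < 2 ^- a * p by rewrite mulr_gt0 ?exp2V_gt0.
have p2p : 2 ^- a * p < p.
  rewrite -p2 /p ltf_pV2 ?posrE ?exp2_gt0// ltr_eXn2l ?ltr1n//; lia.
have gp2 : g (2 ^- a * p) = p.
  rewrite gc0; [by rewrite mulrA exp2K mul1r|rewrite -/p; lra].
have exk : exists k, q < iter k g p by apply: iter_limit.
(* By minimality of [i], the point [q] lies in the image under the [i]-th iterate of the fundamental
   domain [[2^-a p, p)]; [y] is its preimage there. *)
have [i qi imin] := ex_minnP exk.
have i0 : (0 < i)%N by case: i qi imin => //=; lra.
have iq : iter i.-1 g p <= q.
  by rewrite leNgt; apply/negP => /imin; lia.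
have [fi hfi] := iter_thompson i.
have [y hy fy] : exists2 y : R, 0 <= y <= 1 & iter i g y = q.
  have [|y hy e] := pl_surj (thompson_pl fi) (y := q); first by rewrite mulr1n; lra.
  by exists y; rewrite -?hfi.
have yp : y < p.
  rewrite ltNge; apply/negP; rewrite le_eqVlt => /orP[/eqP e|py].
    by rewrite e fy ltxx in qi.
  have := iter_lt i (ltW p0) py; rewrite fy; lra.
have py : 2 ^- a * p <= y.
  rewrite leNgt; apply/negP => ly.
  have := iter_lt i (u := y) (s := 2 ^- a * p); rewrite fy -(prednK i0) iterSr gp2.
  by move=> /(_ _ ly); lra.
have dy : dyadic y.
  apply/(pl_dyadic (thompson_pl fi)); first by rewrite mulr1n.
  rewrite hfi// fy; apply: dyadicB; last exact: dyadic_exp2V.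
  exact: (dyadic_nat R 1).
have [kf hkf] : exists k0, forall k, (k0 <= k)%N -> forall j, (j <= i.+1)%N ->
    forall r, (r < 2 ^ k)%N -> exists z : int, forall s, 0 <= s <= 2 ^- k ->
    iter j g (r%:R / 2 ^+ k + s) = iter j g (r%:R / 2 ^+ k) + 2 ^ z * s.
  elim: i.+1 => [|J [k0 hk0]].
    exists 0%N => k _ j; rewrite leqn0 => /eqP -> r _; exists 0 => s _.
    by rewrite expr0z mul1r.
  have [f hf] := iter_thompson J.+1; have [k2 hk2] := pl_fine (thompson_pl f).
  exists (maxn k0 k2) => k; rewrite geq_max => /andP[kk0 kk2] j.
  rewrite leq_eqVlt ltnS => /orP[/eqP -> r rk|]; last exact: hk0.
  have [|z hz] := hk2 k kk2 r; first by rewrite mul1n.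
  have k20 := exp2_gt0 R k; have kv := exp2V_gt0 R k.
  have r0 : 0 <= r%:R / 2 ^+ k :> R by rewrite divr_ge0 ?ler0n ?ltW.
  have rS : r%:R / 2 ^+ k + 2 ^- k <= 1 :> R.
    have -> : r%:R / 2 ^+ k + 2 ^- k = r.+1%:R / 2 ^+ k :> R.
      by rewrite -[r.+1%:R]natr1 mulrDl mul1r.
    by rewrite ler_pdivrMr// mul1r -natrX ler_nat.
  exists z => s hs; have := hz s hs.
  by rewrite !hf//; lra.
have [kd hkd] : exists k0, forall k, (k0 <= k)%N -> exists r : int, y * 2 ^+ k = r%:~R.
  have [|k0 hk0] := @dyadic_common R [:: y]; first by move=> s; rewrite inE => /eqP ->.
  by exists k0 => k /hk0; apply; rewrite mem_head.
(* On the grid of mesh [2^-D] the ends of the fundamental domain and [y] are grid points, and the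
   iterates up to order [i + 1] are affine between grid points. *)
have [D [Dc Df Dd]] : exists D, [/\ (c0 + a <= D)%N, (kf <= D)%N & (kd <= D)%N].
  by exists (maxn (c0 + a) (maxn kf kd)); rewrite !leq_max !leqnn !orbT.
have {hkd} [r hr] := hkd _ Dd.
have D0 := exp2_gt0 R D; have DV := exp2V_gt0 R D.
have [N0 N0def] : exists N, N = (2 ^ (D - (c0 + a)))%N by eexists.
have N0lt : (N0 < 2 ^ (D - c0))%N 
  by rewrite N0def ltn_exp2l//; move: a_gt0 Dc; clear; lia.
have [m mdef] : exists m, (N0 + m)%N = (2 ^ (D - c0))%N.
  by exists (2 ^ (D - c0) - N0)%N; rewrite subnKC// ltnW.
have m0 : (0 < m)%N by rewrite -(ltn_add2l N0) addn0 mdef.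
have N0E : N0%:R / 2 ^+ D = 2 ^- (c0 + a) :> R.
  by rewrite N0def pow2_ratio.
have N0mE : (N0 + m)%:R / 2 ^+ D = p :> R.
  by rewrite mdef pow2_ratio// (leq_trans (leq_addr _ _) Dc).
have N0m2D : (N0 + m <= 2 ^ D)%N.
  by rewrite mdef leq_exp2l// leq_subr.
pose Y k : R := (N0 + k)%:R / 2 ^+ D.
have YS k : Y k.+1 = Y k + 2 ^- D by rewrite /Y addnS -[(_ + _).+1%:R]natr1 mulrDl mul1r.
have Y0 : Y 0%N = 2 ^- a * p by rewrite /Y addn0 N0E p2.
have Ym : Y m = p by [].
have Y01 k : (k <= m)%N -> 0 <= Y k <= 1.
  move=> km; rewrite divr_ge0 ?ler0n ?(ltW D0)//= ler_pdivrMr// mul1r -natrX ler_nat.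
  by apply: leq_trans N0m2D; rewrite leq_add2l.
have [k1 k1m yk1] : exists2 k1, (k1 < m)%N & y = Y k1.
  have yY (z : nat) : (z%:R / 2 ^+ D <= y) = (z%:Z <= r).
    by rewrite ler_pdivrMr// hr -[z%:R]/((Posz z)%:~R) ler_int.
  have yY' (z : nat) : (y < z%:R / 2 ^+ D) = (r < z%:Z).
    by rewrite ltr_pdivlMr// hr -[z%:R]/((Posz z)%:~R) ltr_int.
  have N0r : N0%:Z <= r by rewrite -yY N0E p2.
  have rm : r < (N0 + m)%:Z by rewrite -yY' N0mE.
  exists (`|r| - N0)%N; first by move: N0r rm; clear; lia.
  have -> : Y (`|r| - N0)%N = r%:~R / 2 ^+ D.
    by rewrite /Y -[(_ + _)%:R]/((Posz (N0 + (`|r| - N0)))%:~R); congr (_%:~R / _); move: N0r; clear; lia.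
  by rewrite -hr mulfK// gt_eqF.
(* The fundamental domain has [m] grid intervals; the quotient of [n] by [m] numbers its image under
   [g] and the remainder the place inside, so a shift by [m] is an application of [g]. *)
pose v n := iter (n %/ m)%N g (Y (n %% m)%N).
have vm n : v (n + m)%N = g (v n).
  by rewrite /v divnDr ?dvdnn// divnn m0 addn1 modnDr.
pose n1 := (i * m + k1)%N.
have n1d : (n1 %/ m = i)%N by rewrite /n1 divnMDl// divn_small// addn0.
have n1m : (n1 %% m = k1)%N by rewrite /n1 modnMDl modn_small.
have vn1 : v n1 = q by rewrite /v n1d n1m -yk1.
have step n : (n < n1 + m)%N -> exists d : nat, forall s, 0 <= s <= 1 ->
    iter (n %/ m)%N g (Y (n %% m)%N + 2 ^- D * s) = v n + 2 ^- d * s.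
  move=> nn; have nm := ltn_pmod n m0.
  have ji : (n %/ m <= i.+1)%N.
    have : (n %/ m <= (n1 + m) %/ m)%N by apply: leq_div2r; exact: ltnW.
    by rewrite divnDr ?dvdnn// divnn m0 addn1 n1d.
  have [|z hz] := hkf D Df _ ji (N0 + n %% m)%N.
    by apply: leq_trans N0m2D; rewrite ltn_add2l.
  rewrite -/(Y _) -/(v n) in hz.
  have zD : 2 ^ z * 2 ^- D = 2 ^ (z - D%:Z) :> R by rewrite exp2zD exprnN.
  have [d dE] : exists d : nat, z - D%:Z = - d%:Z.
    apply: (@exp2z_le1 R); rewrite -zD.
    have /andP[v0 _] : 0 <= v n <= 1 by apply/iter_range/Y01/ltnW.
    have /andP[_ v1] := iter_range (n %/ m)%N (Y01 _ nm).
    have DD : 0 <= (2 ^- D : R) <= 2 ^- D by rewrite lexx ltW.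
    by move: v1; rewrite YS (hz _ DD); lra.
  exists d => s hs; rewrite hz; last by rewrite mulr_ge0 ?ler_piMr ?(ltW DV)//; lra.
  by rewrite mulrA zD dE exprnN.
have [d dP] : exists d : nat -> nat, forall n, (n < n1 + m)%N ->
    forall s, 0 <= s <= 1 ->
    iter (n %/ m)%N g (Y (n %% m)%N + 2 ^- D * s) = v n + 2 ^- d n * s.
  have /choice[d dP] : forall n, exists d : nat, (n < n1 + m)%N ->
      forall s, 0 <= s <= 1 ->
      iter (n %/ m)%N g (Y (n %% m)%N + 2 ^- D * s) = v n + 2 ^- d * s.
    move=> n; have [nn|] := ltnP n (n1 + m); last by exists 0%N.
    by have [d hd] := step n nn; exists d.
  by exists d.
exists v, d, m, n1; split=> //.
- by apply: leq_trans (leq_addr _ _); rewrite leq_pmull.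
- by rewrite /v div0n mod0n /= Y0 p2.
- split=> [n nn|n nn s hs].
    have := dP n nn 1; rewrite !mulr1 lexx ler01 => <-//.
    rewrite -YS /v; have nm := ltn_pmod n m0.
    (* At the end of a block, the last point comes from [p = g (2^-a p)], which makes it the first
       point of the next block. *)
    have [e|ne] := eqVneq (n %% m).+1%N m.
      have dn : n.+1 = ((n %/ m).+1 * m)%N 
        by have := divn_eq n m; move: e; clear; move: (n %/ m)%N (n %% m)%N => A B; rewrite mulSn; lia.
      by rewrite {1 2}dn mulnK// modnMl e Ym -gp2 -iterSr Y0.
    have lt : ((n %% m).+1 < m)%N by rewrite ltn_neqAle ne.
    have -> : (n.+1 %/ m = n %/ m)%N.
      by rewrite {1}(divn_eq n m) -addnS divnMDl// (divn_small lt) addn0.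
    have -> // : (n.+1 %% m = (n %% m).+1)%N.
    by rewrite {1}(divn_eq n m) -addnS modnMDl (modn_small lt).
rewrite -dP//; last by apply: ltn_addr.
have := dP (n + m)%N _ s hs; rewrite divnDr ?dvdnn// divnn m0 addn1 modnDr /=.
by apply; rewrite ltn_add2r.
Qed.

(** [W0] subdivides the fundamental domain ending at [2^-c0], [W1] the one starting at [1 - 2^-c1],
    and [mu] what lies between. They are cut out of the single sequence [v], which [g] shifts by
    [m]. *)
Lemma expanding_data : exists (c0 c1 : nat) (W0 mu W1 : seq nat),
  [/\ forall u, 0 <= u <= 2 ^- c0 -> g u = 2 ^+ a * u,
      forall u, 0 <= u <= 2 ^- c1 -> g (1 - u) = 1 - 2 ^- b * u,
      [/\ tot R W0 = 2 ^- c0 - 2 ^- (c0 + a), tot R W1 = 2 ^- c1 - 2 ^- (c1 + b) &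
          tot R mu = 1 - 2 ^- c1 - 2 ^- c0] &
      carries g (2 ^- (c0 + a)) (W0 ++ mu) (2 ^- c0) (mu ++ W1)].
Proof.
have [c0 [c1 [c00 c10 c01 h0 h1]]] := germ_scales.
have [v [d [m [n1 [mn v0 vn1 vm [vS gv]]]]]] := itinerary c00 c10 c01 h0.
pose W k n := [seq d i | i <- iota k n].
have totW k n : (k + n <= n1 + m)%N -> tot R (W k n) = v (k + n)%N - v k.
  elim: n k => [|n IH] k hk; first by rewrite tot_nil addn0 subrr.
  rewrite /W /= -/(W k.+1 n) tot_cons IH; last by lia.
  by rewrite addSnnS vS; [lra|lia].
have carW k n : (k + n <= n1)%N -> carries g (v k) (W k n) (v (k + m)%N) (W (k + m)%N n).
  elim: n k => [|n IH] k hk /=; first by rewrite vm.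
  split; last first.
    rewrite -!vS; try lia; have := IH k.+1; rewrite addSn; apply; lia.
  move=> s /andP[s0 s1]; have dk := exp2K R (d k).
  have -> : s = 2 ^- d k * (2 ^+ d k * s) by rewrite mulrA [2 ^- _ * _]mulrC dk mul1r.
  rewrite gv; last 2 first.
  - by lia.
  - rewrite mulr_ge0 ?(ltW (exp2_gt0 _ _))//=.
    by move: s1; rewrite -(ler_pM2l (exp2_gt0 R (d k))) dk.
  rewrite !mulrA; congr (_ + _ * _); rewrite -!mulrA [2 ^- d k * _]mulrC dk mulr1.
  by rewrite mulrC.
have v_m : v m = 2 ^- c0.
  rewrite -[m]add0n vm v0 h0 ?exprD ?invfM.
    by rewrite mulrCA exp2K mulr1.
  rewrite mulr_ge0 ?ler_piMr ?(ltW (exp2V_gt0 _ _))//.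
  by rewrite invf_le1 ?exp2_gt0// exprn_ege1// ler1n.
have vn1m : v (n1 + m)%N = 1 - 2 ^- (c1 + b).
  by rewrite vm vn1 h1 ?exprD ?invfM 1?mulrC// lexx ltW ?exp2V_gt0.
have s0 : W 0%N m ++ W m (n1 - m)%N = W 0%N n1.
  by rewrite /W -map_cat -iotaD subnKC.
have s1 : W m (n1 - m)%N ++ W n1 m = W m n1.
  by rewrite /W -map_cat -{2}(subnKC mn) -iotaD subnK.
exists c0, c1, (W 0%N m), (W m (n1 - m)%N), (W n1 m); split=> //.
  rewrite !totW; try lia.
  by rewrite !add0n v_m v0 vn1m vn1 subnKC// vn1; split=> //; lra.
by rewrite s0 s1 -v_m -[m in v m]add0n -v0; have := carW 0%N n1 (leqnn _); rewrite add0n.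
Qed.

End Dynamics.

(** * Upper bound *)

Section UpperBound.
Variable R : realType.

Lemma tot_iota d a : tot R (iota d.+1 a) = 2 ^- d - 2 ^- (d + a).
Proof.
elim: a d => [|a IH] d; first by rewrite tot_nil addn0 subrr.
by rewrite tot_cons IH addnS addSn (exp2VS R d); lra.
Qed.

Lemma tot_rev ds : tot R (rev ds) = tot R ds.
Proof. by apply: perm_big; rewrite perm_rev. Qed.

Lemma tot_scale a ds : tot R (map (addn a) ds) = 2 ^- a * tot R ds.
Proof.
by rewrite /tot big_map mulr_sumr; apply: eq_bigr => d _; rewrite exprD invfM.
Qed.

Lemma adj_tot (c : R) L M : adj c L M -> tot R (depths L) = tot R (depths M).
Proof.
move=> [T [_ _ /eqv_tot -> /eqv_tot <- _]]; congr tot.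
by rewrite /depths -!map_comp.
Qed.

Lemma carries_pt (g : thompson R 1) (L M : seq (nat * R)) x :
  carries g 0 (depths M) 0 (depths L) -> tot R (depths M) = 1 ->
  tot R (depths L) = 1 -> map snd M = map snd L -> is_pt L x -> is_pt M (act g x).
Proof.
move=> cg tM tL snds [n [f [t [nE fE tE ->]]]].
have sz : size M = size L by rewrite -(size_map snd M) snds size_map.
exists n, (thompson_comp f g), t; split; first by rewrite sz.
- apply: funext => u /=; rewrite fE.
  have in01 w : 0 <= w <= 1 -> plf 0 (depths L) (g w) = plf 0 (depths M) w.
    by move=> hw; apply: (carries_plf cg); rewrite tM add0r.
  have [u0|u0] := leP u 0.
    by rewrite (thompson_le0 g u0) (plf_le0 _ u0) in01// lexx ler01.
  have [u1|u1] := leP 1 u.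
    by rewrite (thompson_ge1 g u1) (plf_ge1 tM u1) in01// lexx ler01.
  by rewrite in01// !ltW.
- move=> i; rewrite tE.
  have iL : (i < size L)%N by rewrite -nE.
  by rewrite -(nth_map _ 0 snd)// -snds (nth_map (0%N, 0))// sz.
- by rewrite act_to_X.
Qed.

Lemma snd_zl ds : map snd (zl R ds) = nseq (size ds) 0.
Proof. by elim: ds => //= d ds ->. Qed.

Lemma snd_deepen a (L : seq (nat * R)) : map snd (deepen a L) = map snd L.
Proof. by rewrite -map_comp. Qed.

(* Assembles the blocks [X] near 0 and [X'] near 1 into a point [Lx]; its
   translate is [Lg]. The two lists differ by [a] subdivisions of the first
   interval, [b] of the last one, and the cheap passages [X -> Y], [X' -> Y']. *)
Lemma expanding_upper (g : thompson R 1) a b e :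
  (forall u, 0 < u -> u < 1 -> u < g u) -> (0 < a)%N -> (0 < b)%N ->
  germ0 g a%:Z -> germ1 g (- b%:Z) -> 0 < e ->
  exists x, distX (act g x) x <= Num.sqrt (a%:R ^+ 2 + b%:R ^+ 2 + e).
Proof.
move=> g_gt a0 b0 g0 g1 e0.
have [c0 [c1 [W0 [mu [W1 [h0 h1 [tW0 tW1 tmu] car]]]]]] :=
  expanding_data g_gt a0 g0 g1.
have e2 : 0 < e / 2 by rewrite divr_gt0.
(* [La] and [P] cut the same fundamental domains as [W0] and [W1], but at the points [2^-k] and
   [1 - 2^-k]. *)
pose La := rev (iota c0.+1 a); pose P := iota c1.+1 b.
have [|c ce hc] := @joined_tot R La W0 _ _ e2.
  by rewrite tot_rev tot_iota tW0.
have [|c' ce' hc'] := @joined_tot R W1 P _ _ e2.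
  by rewrite tot_iota tW1.
have [n [X [Y [hXY eXY]]]] := cpath_left_blocks a hc.
have [n' [X' [Y' [hXY' eXY']]]] := cpath_right_blocks b hc'.
pose k0 := (c0 + a * n.+1)%N; pose k1 := (c1 + b * n')%N.
pose A := zl R [:: k0] ++ X ++ zl R W0; pose B := Y' ++ zl R [:: k1].
pose Lx := A ++ zl R (mu ++ W1) ++ deepen b B.
pose Lg := deepen a A ++ zl R (W0 ++ mu) ++ B.
(* Both lists are regrouped into five matching blocks: an interval of depth [k0] against its
   [a]-fold split, [X] against [Y], a common middle, [X'] against [Y'], and a [b]-fold split against
   the interval of depth [k1]. *)
have LxE : Lx = zl R [:: k0] ++ X ++ zl R (W0 ++ mu) ++ X' ++
    zl R (rcons (iota k1.+1 b) (k1 + b)%N).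
  rewrite /Lx /A /B deepen_cat !zl_cat -!catA (catA (zl R W1)) eXY' -!catA.
  do 5!congr (_ ++ _); rewrite !deepen_zl -zl_cat -cats1 /P -iotaDl addnS.
  by rewrite /k1 /= [(b + _)%N]addnC [(b * n' + _)%N]addnC.
have LgE : Lg = zl R ((k0 + a)%N :: rev (iota k0.+1 a)) ++ Y ++ zl R (W0 ++ mu) ++ Y' ++
    zl R [:: k1].
  have <- : deepen a (zl R [:: k0]) ++ deepen (a * n.+1) (zl R La) =
      zl R ((k0 + a)%N :: rev (iota k0.+1 a)).
    rewrite !deepen_zl -zl_cat /= /La map_rev -iotaDl addnS.
    by rewrite /k0 [(a + _)%N]addnC [(a * n.+1 + _)%N]addnC.
  by rewrite /Lg /A /B deepen_cat -eXY -!catA.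
have dd (x y : nat) : 2 ^- (x + y) = 2 ^- x * 2 ^- y :> R by rewrite exprD invfM.
pose al : R := 2 ^- a; pose be : R := 2 ^- b; pose ka : R := 2 ^- c0; pose kb : R := 2 ^- c1.
have al1 : al < 1 by rewrite invf_lt1 ?exp2_gt0// exprn_egt1 ?ltr1n// -lt0n.
have be1 : be < 1 by rewrite invf_lt1 ?exp2_gt0// exprn_egt1 ?ltr1n// -lt0n.
(* Since [X] and [Y] have the same length, [eXY] is a linear equation for it, solvable because
   [al < 1]. The length of [B] is found in the same way. *)
have tA : tot R (depths A) = ka.
  have := congr1 (tot R) (congr1 (@depths R) eXY).
  rewrite deepen_cat !depths_cat !deepen_depths !tot_cat !tot_scale !depths_zl.
  rewrite tot_rev tot_iota tW0 -(adj_tot hXY).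
  rewrite tot_cons tot_nil addr0 /k0 !dd.
  rewrite -/al -/ka; set t := tot _ _; set an := 2 ^- _ => et.
  apply: (@mulfI _ (1 - al)); first by rewrite subr_eq0 eq_sym lt_eqF.
  by move: et; lra.
have tB : tot R (depths B) = kb.
  have := congr1 (tot R) (congr1 (@depths R) eXY').
  rewrite !depths_cat !deepen_depths !tot_cat !tot_scale !depths_zl.
  rewrite tot_iota tW1 -(adj_tot hXY').
  rewrite tot_cons tot_nil addr0 /k1 !dd.
  rewrite -/be -/kb; set t := tot _ _; set bn := 2 ^- _ => et.
  apply: (@mulfI _ (1 - be)); first by rewrite subr_eq0 eq_sym lt_eqF.
  by move: et; lra.
have tLx : tot R (depths Lx) = 1.
  rewrite /Lx (depths_cat A) (depths_cat (zl R _) (deepen b B)) depths_zl.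
  rewrite deepen_depths !tot_cat tot_scale tA tB tW1 tmu.
  by rewrite dd -/kb -/be -/ka; lra.
have tLg : tot R (depths Lg) = 1.
  rewrite /Lg (depths_cat (deepen a A)) (depths_cat (zl R _) B) depths_zl.
  rewrite deepen_depths !tot_cat tot_scale tA tB tW0 tmu.
  by rewrite dd -/kb -/al -/ka; lra.
have [T [cX cY _ _ _]] := hXY; have [T' [cX' cY' _ _ _]] := hXY'.
have vLx : valid Lx by split=> //; rewrite LxE !cval_cat cX cX' !cval_zl.
have [x hx] := valid_pt vLx.
have tsA : tot R (map (addn a) (depths A)) = 2 ^- (c0 + a).
  by rewrite tot_scale tA dd mulrC.
(* The germ at 0 carries [deepen a A] to [A], [car] treats the middle, and the germ at 1 carries [B]
   to [deepen b B]. *)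
have car' : carries g 0 (depths Lg) 0 (depths Lx).
  rewrite /Lg /Lx (depths_cat A) (depths_cat (deepen a A)).
  rewrite !(depths_cat (zl R _)) !depths_zl !deepen_depths.
  apply: carries_cat.
    apply: carries_scale_dn => s; rewrite tsA dd => /andP[s0 s1].
    rewrite !add0r h0// s0 (le_trans s1)// ler_piMr ?ltW//; exact: exp2V_gt0.
  rewrite tsA tA !add0r; apply: (carries_cat car).
  rewrite !tot_cat tW0 tW1 tmu.
  have -> : 2 ^- (c0 + a) + (2 ^- c0 - 2 ^- (c0 + a) + (1 - 2 ^- c1 - 2 ^- c0)) = 1 - kb.
    by rewrite /kb; lra.
  have -> : ka + (1 - 2 ^- c1 - 2 ^- c0 + (2 ^- c1 - 2 ^- (c1 + b))) = 1 - be * kb.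
    by rewrite dd /ka -/kb -/be; lra.
  apply: carries_scale_up => s; rewrite tB => /andP[s0 s1].
  have -> : 1 - kb + s = 1 - (kb - s) by lra.
  by rewrite h1 -/be -?/kb; lra.
have szW : size W0 = size W1.
  by have := carries_size car; rewrite !size_cat; lia.
have hgx : is_pt Lg (act g x).
  apply: (carries_pt car' tLg tLx _ hx).
  rewrite /Lg /Lx (map_cat snd A) (map_cat snd (deepen a A)) !(map_cat snd (zl R _)).
  by rewrite !snd_deepen !snd_zl !size_cat szW [(size W1 + _)%N]addnC.
(* In [a b] simultaneous moves, the [a] splits on the left advance by [1/b] per move and the [b]
   splits on the right by [1/a]; the square of the total length is then at most
   [a^2 + b^2 + c + c']. *)
set N := (a * b)%N; have N_gt0 : (0 < N)%N by rewrite muln_gt0 a0.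
have hp : steps N (1 / b%:R ^+ 2 + (c / N%:R ^+ 2 + (0 + (c' / N%:R ^+ 2 + 1 / a%:R ^+ 2)))) Lx Lg.
  rewrite LxE LgE; apply: steps_cat; first exact: steps_left_split.
  apply: steps_cat; first by apply: adj_steps.
  apply: steps_cat; first by apply/steps_refl/cval_zl.
  apply: steps_cat; first by apply: adj_steps.
  by apply: steps_sym; rewrite /N mulnC; apply: steps_right_split.
have [y [l [hy cl hl]]] := steps_chain hp vLx hx.
exists x; rewrite distXC; apply: le_trans (distX_le _) _.
  by rewrite (is_pt_uniq hgx hy); exact: cl.
apply: (le_trans hl).
have N0 : (0 : R) <= N%:R by apply: ler0n.
rewrite -[X in X * _](ger0_norm N0) -sqrtr_sqr -sqrtrM ?sqr_ge0//.
apply: ler_wsqrtr; rewrite /N natrM.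
set p := a%:R; set q := b%:R.
have p0 : p != 0 by rewrite pnatr_eq0 -lt0n.
have q0 : q != 0 by rewrite pnatr_eq0 -lt0n.
rewrite (_ : (p * q) ^+ 2 * _ = p ^+ 2 + q ^+ 2 + (c + c')); first by lra.
by field; rewrite p0 q0.
Qed.

End UpperBound.

(** * Irreducible elements *)

Section Irreducible.
Variable R : realType.
Local Open Scope classical_set_scope.
Implicit Types (g h : thompson R 1) (u : R).

Lemma irreducible_fix g u : irreducible g -> 0 < u -> u < 1 -> g u != u.
Proof.
move=> gi u0 u1; apply/eqP => gu.
have : [set x : R | 0 <= x <= 1 /\ g x = x]%classic u by rewrite /= !ltW.
by rewrite gi => -[] /= e; move: u0 u1; rewrite e ltxx.
Qed.

(** Near 0 the germ gives [w < g w]; a point with [g u < u] would force a fixed point in between by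
    the intermediate value theorem. *)
Lemma irreducible_gt g : irreducible g -> 0 < slope0 g ->
  forall u, 0 < u -> u < 1 -> u < g u.
Proof.
move=> gi s0 u u0 u1; rewrite ltNge; apply/negP => gu.
have {}gu : g u < u by rewrite lt_neqAle irreducible_fix.
have [e e0 he] := germ0_slope0 g.
pose w := Num.min e (u / 2).
have w0 : 0 < w by rewrite lt_min e0 divr_gt0.
have we : w <= e by rewrite ge_min lexx.
have wu : w < u.
  have : w <= u / 2 by rewrite ge_min lexx orbT.
  lra.
have gw : w < g w.
  rewrite he ?(ltW w0)// -[ltLHS]mul1r ltr_pM2r//.
  by case: (slope0 g) s0 => [[|m]|m] // _; rewrite -exprnP exprn_egt1 ?ltr1n.
have [cg _ _] := thompson_pl g.
have sub : (`[w, u] `<=` `[0, 1%:R])%classic.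
  by move=> x /=; rewrite !in_itv /= => /andP[wx xu]; rewrite mulr1n; apply/andP; split; lra.
have cf : {within `[w, u]%classic, continuous (fun x : R => g x - x)}.
  move=> x; apply: cvgB; last exact: (continuous_subspaceT (fun y => @cvg_id _ (nbhs y))).
  exact: (continuous_subspaceW sub cg).
have [|x] := @IVT R (fun x : R => g x - x) w u 0 (ltW wu) cf.
  by rewrite ge_min le_max; apply/andP; split; apply/orP; [right|left]; lra.
rewrite in_itv /= => /andP[wx xu] /eqP; rewrite subr_eq0; apply/negP.
by apply: (irreducible_fix gi); lra.
Qed.

Lemma irreducible_slope0 g : irreducible g -> slope0 g != 0.
Proof.
move=> gi; apply/eqP => s0; have [e e0 he] := germ0_slope0 g.
pose w := Num.min e (2^-1).
have w0 : 0 < w by rewrite lt_min e0 invr_gt0 ltr0n.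
have we : w <= e by rewrite ge_min lexx.
have w1 : w < 1.
  have : w <= 2^-1 by rewrite ge_min lexx orbT.
  lra.
have /eqP := irreducible_fix gi w0 w1; apply.
by rewrite he ?(ltW w0)// s0 expr0z mul1r.
Qed.

Lemma gtz0_nat (z : int) : 0 < z -> exists2 a : nat, (0 < a)%N & z = a%:Z.
Proof. by case: z => [[|m]|m] // _; exists m.+1. Qed.

Lemma irreducible_slope1 g : irreducible g -> 0 < slope0 g -> slope1 g < 0.
Proof.
move=> gi s0; have [e e0 he] := germ1_slope1 g.
pose w := Num.min e (2^-1).
have w0 : 0 < w by rewrite lt_min e0 invr_gt0 ltr0n.
have we : w <= e by rewrite ge_min lexx.
have w1 : w < 1.
  have : w <= 2^-1 by rewrite ge_min lexx orbT.
  lra.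
have := irreducible_gt gi s0 (u := 1 - w) (ltac:(lra)) (ltac:(lra)).
rewrite he ?(ltW w0)// thompson_1 mulr1n => hlt.
have {hlt} : 2 ^ slope1 g * w < 1 * w by lra.
rewrite ltr_pM2r//; case: (slope1 g) => // m.
by rewrite -exprnP ltNge exprn_ege1// ler1n.
Qed.

Lemma irreducible_upper_gt g e : irreducible g -> 0 < slope0 g -> 0 < e ->
  exists x, distX (act g x) x <=
    Num.sqrt ((slope0 g)%:~R ^+ 2 + (slope1 g)%:~R ^+ 2 + e).
Proof.
move=> gi s0 e0; have [a a0 aE] := gtz0_nat s0.
have [b b0 bE] : exists2 b : nat, (0 < b)%N & - slope1 g = b%:Z.
  by apply: gtz0_nat; rewrite oppr_gt0; apply: irreducible_slope1.
have bE' : slope1 g = - b%:Z by rewrite -bE opprK.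
have := @expanding_upper R g a b e (irreducible_gt gi s0) a0 b0.
rewrite -aE -bE' => /(_ (germ0_slope0 g) (germ1_slope1 g) e0)[x hx]; exists x.
by rewrite aE bE' rmorphN sqrrN.
Qed.

Lemma irreducible_upper g e : irreducible g -> 0 < e ->
  exists x, distX (act g x) x <=
    Num.sqrt ((slope0 g)%:~R ^+ 2 + (slope1 g)%:~R ^+ 2 + e).
Proof.
move=> gi e0; case: (ltgtP 0 (slope0 g)) => s0; first exact: irreducible_upper_gt.
  have [h [hg gh]] := thompson_inverse g.
  have h0 : slope0 h = - slope0 g.
    apply/eqP; rewrite -addr_eq0 addrC; apply/eqP.
    apply: (germ0_uniq (germ0_comp g h)); exists 1 => // u hu.
    by rewrite /= gh// expr0z mul1r.
  have h1 : slope1 h = - slope1 g.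
    apply/eqP; rewrite -addr_eq0 addrC; apply/eqP.
    apply: (germ1_uniq (germ1_comp g h)); exists 1 => // u hu.
    rewrite /= !gh ?expr0z ?mul1r ?lexx ?ler01//; lra.
  have hi : irreducible h.
    rewrite /irreducible -gi; apply/seteqP; split=> u /= [u01 fu]; split=> //.
      by rewrite -{1}fu gh.
    by rewrite -{1}fu hg.
  have [|x hx] := irreducible_upper_gt hi _ e0; first by rewrite h0 oppr_gt0.
  (* With [h] the inverse of [g], the displacement of [h x] under [g] equals that of [x] under [h],
     and the squares of the slopes' exponents agree. *)
  exists (act h x); rewrite (act_cancel hg) distXC.
  by move: hx; rewrite h0 h1 !rmorphN !sqrrN.
by have /eqP := irreducible_slope0 gi; rewrite s0.
Qed.

Lemma translation_length_act g : irreducible g ->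
  translation_length (act g) =
    Num.sqrt ((slope0 g)%:~R ^+ 2 + (slope1 g)%:~R ^+ 2).
Proof.
move=> gi; set c := Num.sqrt _.
have c0 : 0 <= c := sqrtr_ge0 _.
have cc : c ^+ 2 = (slope0 g)%:~R ^+ 2 + (slope1 g)%:~R ^+ 2.
  by rewrite sqr_sqrtr// addr_ge0 ?sqr_ge0.
have lb x : c <= distX (act g x) x := distX_act_ge g x.
have le_c : c <= translation_length (act g).
  have [x _] := irreducible_upper gi ltr01.
  by apply: lb_le_inf; [exists (distX (act g x) x); exists x|move=> _ [y _ <-]].
apply/eqP; rewrite eq_le le_c andbT leNgt; apply/negP => ct.
set t := translation_length _ in ct le_c.
(* Half of the gap between the squares leaves a displacement strictly below [t]. *)
have e0 : 0 < (t ^+ 2 - c ^+ 2) / 2 by rewrite divr_gt0// subr_gt0 ltr_pXn2r ?nnegrE//; lra.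
have [x hx] := irreducible_upper gi e0.
have tx : t <= distX (act g x) x.
  by apply: ge_inf; [exists c => _ [y _ <-]|exists x].
have := le_trans tx hx; apply/negP; rewrite -ltNge -cc.
have t0 : 0 < t by lra.
rewrite -[ltRHS](ger0_norm (ltW t0)) -sqrtr_sqr ltr_sqrt ?exprn_gt0//; lra.
Qed.

End Irreducible.

Theorem theorem1 (R : realType) (g : thompson R 1) (g_irr : irreducible g) :
  translation_length (act g) =
    Num.sqrt (log2 (right_derivative g 0) ^+ 2 + log2 (left_derivative g 1) ^+ 2)
  /\ (right_derivative g 0 * left_derivative g 1 <> 1 -> parabolic (act g)).
Proof.
rewrite (right_derivative_germ (germ0_slope0 g)) (left_derivative_germ (germ1_slope1 g)).
rewrite !log2_exp -exp2zD (translation_length_act g_irr); split=> // slopes.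
split; first exact: act_isometry.
move=> [x]; rewrite (translation_length_act g_irr) => dx.
have := @distX_act_gt R g x; rewrite dx ltxx -intrD intr_eq0.
have [s0 _|_ /(_ isT)//] := eqVneq (slope0 g + slope1 g) 0.
by apply: slopes; rewrite s0 expr0z.
Qed.
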